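(* Let $V$ be a real vector space with $\dim V=3$. Then $S\in \mathcal{C}_W$ is extremal in $\mathcal{C}_W$ if and only if it is of one of the following types: 1. $S=\alpha^4$ for some $\alpha\in V^*\setminus\{0\}$. 2. $S=(\alpha_1\vee\alpha_2)^{\otimes 2}+(\alpha_1\wedge\alpha_2)^{\otimes 2}$ for some linearly independent $\alpha_1,\alpha_2\in V^*$. 3. For some basis $\{\alpha_1,\alpha_2,\alpha_3\}$ of $V^*$ and some parameters $g,d,h\in\mathbb{R}$ with $g^2>1-d^2+dh$, $$S=S_{\mathrm{tot}}+2\,(g^2+d^2-1-dh)\left[(\alpha_2\otimes\alpha_3)^{\otimes 2}+(\alpha_3\otimes\alpha_2)^{\otimes 2}\right],$$ where $$\begin{aligned}S_{\mathrm{tot}}=&\,\alpha_1^4+6\,\alpha_1^2\alpha_2^2+6\,\alpha_1^2\alpha_3^2+12d\,\alpha_1\alpha_2^2\alpha_3+12g\,\alpha_1\alpha_2\alpha_3^2+4h\,\alpha_1\alpha_3^3+(1+d^2)\,\alpha_2^4\\&+4dg\,\alpha_2^3\alpha_3+6(1+dh)\,\alpha_2^2\alpha_3^2+4g(d+h)\,\alpha_2\alpha_3^3+(1+g^2+h^2)\,\alpha_3^4.\end{aligned}$$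
   Context: Conventions: $u\vee v=\frac12(u\otimes v+v\otimes u)$, $u\wedge v=\frac12(u\otimes v-v\otimes u)$. For one-forms, juxtaposition denotes the totally symmetric product $\beta_1\beta_2\cdots\beta_k=\frac1{k!}\sum_{\sigma\in S_k}\beta_{\sigma(1)}\otimes\cdots\otimes\beta_{\sigma(k)}$, and $\beta^k=\beta\cdots\beta$ ($k$ factors). $W:=\{S\in \mathrm{Sym}^2(\mathrm{Sym}^2V^* )\oplus\mathrm{Sym}^2(\Lambda^2V^* ):\tau S=S\}\subset (V^* )^{\otimes 4}$, where $(\tau S)(v_1,v_2,v_3,v_4)=S(v_1,v_4,v_3,v_2)$. Here $\mathrm{Sym}^2(\mathrm{Sym}^2V^* )\oplus\mathrm{Sym}^2(\Lambda^2V^* )\subset\mathrm{Sym}^2(V^*\otimes V^* )$, so each $S\in W$ is regarded as a symmetric bilinear form on $V\otimes V$ via $S(a\otimes b,c\otimes d)=S(a,b,c,d)$. $\mathcal{C}_W:=\{S\in W: S\ge 0\}$ is the cone of those elements that are positive semi-definite as bilinear forms on $V\otimes V$. An element $x\neq0$ of a convex cone $\mathcal{C}$ is extremal if it generates an extremal ray; equivalently, whenever $x=x_0+x_1$ with $x_0,x_1\in\mathcal{C}$, one has $x_0,x_1\in\mathbb{R}_{\ge0}x$. *)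

(* Defs.v *)
From HB Require Import structures.
From mathcomp Require Import all_boot all_order all_algebra all_fingroup.
From mathcomp Require Import boolp classical_sets functions reals.

Set Implicit Arguments.
Unset Strict Implicit.
Unset Printing Implicit Defensive.

Import GRing.Theory Num.Theory.

Local Open Scope ring_scope.


(* Covariant tensors are maps on vectors, with the pointwise vector space
   structure; (V^* )^{\otimes 4} consists of those satisfying [multilinear4]. *)
Notation tensor2 R V := (V -> V -> R^o).
Notation tensor4 R V := (V -> V -> V -> V -> R^o).

Section Tensors.
Variables (R : realType) (V : vectType R).
Implicit Types (u v : 'Hom(V, R^o)) (A B : tensor2 R V) (S T : tensor4 R V).

Definition multilinear4 T : Prop :=
  [/\ forall b c d : V, scalar (fun x => T x b c d),
      forall a c d : V, scalar (fun x => T a x c d),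
      forall a b d : V, scalar (fun x => T a b x d) &
      forall a b c : V, scalar (fun x => T a b c x)].

Definition otimes u v : tensor2 R V := fun x y => u x * v y.

Definition otimes2 A B : tensor4 R V := fun x y z w => A x y * B z w.

Definition vee u v : tensor2 R V := 2^-1 *: (otimes u v + otimes v u).

Definition wedge u v : tensor2 R V := 2^-1 *: (otimes u v - otimes v u).

(* The totally symmetric product b1 b2 b3 b4. *)
Definition sprod4 (b1 b2 b3 b4 : 'Hom(V, R^o)) : tensor4 R V :=
  let b := tnth [tuple b1; b2; b3; b4] in
  (4`!%:R)^-1 *: \sum_(s : 'S_4)
    otimes2 (otimes (b (s 0)) (b (s 1))) (otimes (b (s 2)) (b (s 3))).

Definition Sym2Sym2 T : Prop :=
  [/\ multilinear4 T,
      forall a b c d, T b a c d = T a b c d,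
      forall a b c d, T a b d c = T a b c d &
      forall a b c d, T c d a b = T a b c d].

Definition Sym2Alt2 T : Prop :=
  [/\ multilinear4 T,
      forall a b c d, T b a c d = - T a b c d,
      forall a b c d, T a b d c = - T a b c d &
      forall a b c d, T c d a b = T a b c d].

Definition tau S : tensor4 R V := fun a b c d => S a d c b.

Definition W : set (tensor4 R V) :=
  [set S | (exists S1 S2, [/\ Sym2Sym2 S1, Sym2Alt2 S2 & S = S1 + S2])
           /\ tau S = S].

(* Positive semi-definiteness on V \otimes V, whose elements are the finite
   sums \sum_i a i \otimes b i. *)
Definition psd S : Prop :=
  forall (n : nat) (a b : 'I_n -> V),
    0 <= \sum_(i < n) \sum_(j < n) S (a i) (b i) (a j) (b j).

Definition C_W : set (tensor4 R V) := [set S | W S /\ psd S].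

Definition S_tot (a1 a2 a3 : 'Hom(V, R^o)) (d g h : R) : tensor4 R V :=
  sprod4 a1 a1 a1 a1
  + 6 *: sprod4 a1 a1 a2 a2
  + 6 *: sprod4 a1 a1 a3 a3
  + (12 * d) *: sprod4 a1 a2 a2 a3
  + (12 * g) *: sprod4 a1 a2 a3 a3
  + (4 * h) *: sprod4 a1 a3 a3 a3
  + (1 + d ^+ 2) *: sprod4 a2 a2 a2 a2
  + (4 * d * g) *: sprod4 a2 a2 a2 a3
  + (6 * (1 + d * h)) *: sprod4 a2 a2 a3 a3
  + (4 * g * (d + h)) *: sprod4 a2 a3 a3 a3
  + (1 + g ^+ 2 + h ^+ 2) *: sprod4 a3 a3 a3 a3.

End Tensors.

Definition extremal (R : realType) (E : lmodType R) (C : set E) (x : E) : Prop :=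
  [/\ C x, x != 0 &
      forall x0 x1 : E, C x0 -> C x1 -> x = x0 + x1 ->
        (exists2 c : R, 0 <= c & x0 = c *: x) /\
        (exists2 c : R, 0 <= c & x1 = c *: x)].

(* Main.v *)
(* An element S of W is the same datum as a symmetric bilinear form G on Sym^2 V
   (its part [symp S]); its part K in Sym^2 (Lambda^2 V^* ), [altp S], is determined
   linearly by G: if G is the sum of the squares of quadratic forms q_i, then K is
   minus the sum of the adjugates of the q_i.  So C_W is the cone of the G >= 0
   with K(G) >= 0.

   Suppose S is extremal, with G of rank r and K of rank s.  Counting dimensions,
   r(r+1)/2 + s(s+1)/2 <= 7, since otherwise S can be perturbed within its range.
   If the range of S contains a product a (x) b, then so does it contain b (x) a,
   and S is proportional to (a (x) b)^2 + (b (x) a)^2, that is, of type 1 or 2.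
   If s <= 1, some e <> 0 satisfies K(e, . , . , . ) = 0, which means that
   <q(e,x), q(y,z)> is symmetric in x, y, z, where q = (q_1, .., q_r).  When
   q(e, . ) has a kernel, a null vector of a pencil of binary forms yields a
   product in the range.  When it is injective, q is described by a cubic form on
   V; an orthonormal basis in which one coefficient of this cubic vanishes puts S
   in the normal form 3.  If s = 0, a real root of the cubic det q(e, . ) provides
   an e for which q(e, . ) is singular.  The remaining ranks (1, s) and (2, 2)
   always give a product.

   Conversely, a summand of S in C_W has its range in the range of S, and
   tau-invariance forces it to be a multiple of S. *)
Require Import Defs.
From HB Require Import structures.
From mathcomp Require Import all_boot all_order all_algebra all_fingroup.
From mathcomp Require Import boolp classical_sets functions reals.
From mathcomp Require Import ring lra.

Set Implicit Arguments.
Unset Strict Implicit.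
Unset Printing Implicit Defensive.

Import Order.TTheory GRing.Theory Num.Theory.

Local Open Scope ring_scope.

(** The number 7 is 6 + 1: the defect of invariance under tau is a symmetric form on Lambda^2 V,
    hence six linear conditions, and one more dimension is taken by the multiples of S. A product in
    the range is decisive because (a (x) b)^2 + (b (x) a)^2 is itself fixed by tau, so that S can be
    moved in both directions along it. A vector e killed by K is useful because G(e, . , . , . ) is
    then totally symmetric, a cubic form, with G(e, e, . , . ) = <q(e, . ), q(e, . )>. If q(e, . )
    is injective this is an inner product, and three vectors q(e, b_j) along an orthonormal basis
    are orthonormal in R^3, so the cubic recovers all of G, hence S. Its remaining coefficients are
    d, g, h, and the inequality imposed on them says K > 0 on the bivector that K sees; if K = 0,
    another choice of e makes q(e, . ) singular. For s = 2 no common kernel vector need exist: what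
    survives is a bivector x /\ y killed by K, and the argument is redone on the plane spanned by x
    and y. *)

Lemma quadratic_discr_le (R : realFieldType) (a b c : R) :
  (forall t, 0 <= a * t ^+ 2 + 2 * b * t + c) -> b ^+ 2 <= a * c.
Proof.
move=> H; have [a0|an0] := eqVneq a 0.
  have [b0|bn0] := eqVneq b 0; first by rewrite a0 b0 expr0n /= mul0r.
  (* The affine function takes the value -1 here. *)
  have := H (- (c + 1) / (2 * b)).
  rewrite a0 mul0r add0r.
  have -> : 2 * b * (- (c + 1) / (2 * b)) + c = -1 by field.
  by move=> h; have : (0 : R) <= -1 by []; rewrite oppr_ge0 ler10.
have ap : 0 < a.
  rewrite lt_def an0 /=; rewrite leNgt; apply/negP => aneg.
  (* With z = b^2 - a c, the value at this point is ((z + 1)^2 - z) / a, which is negative; no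
     square root is needed. *)
  have h1 := H 0; have h2 := H ((- b - (b ^+ 2 - a * c + 1)) / a).
  have E : a * ((- b - (b ^+ 2 - a * c + 1)) / a) ^+ 2
     + 2 * b * ((- b - (b ^+ 2 - a * c + 1)) / a) + c
     = ((b ^+ 2 - a * c + 1) ^+ 2 - (b ^+ 2 - a * c)) / a by field.
  rewrite E in h2.
  have h3 : (b ^+ 2 - a * c + 1) ^+ 2 - (b ^+ 2 - a * c) > 0.
    set z := b ^+ 2 - a * c; have := sqr_ge0 (z + 2^-1); nra.
  have : ((b ^+ 2 - a * c + 1) ^+ 2 - (b ^+ 2 - a * c)) / a < 0.
    by rewrite pmulr_rlt0 // invr_lt0.
  lra.
have := H (- b / a).
have -> : a * (- b / a) ^+ 2 + 2 * b * (- b / a) + c = (a * c - b ^+ 2) / a by field.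
by rewrite pmulr_lge0 ?invr_gt0 // subr_ge0.
Qed.

(** * Bilinear and quadrilinear forms, evaluated on V (x) V *)

Section Forms.
Variables (R : realType) (V : vectType R).
Implicit Types (f g : V -> V -> R) (S X : V -> V -> V -> V -> R) (s t : seq (V * V)).

Definition bilin f :=
  (forall a x y z, f (a *: x + y) z = a * f x z + f y z) /\
  (forall a x y z, f z (a *: x + y) = a * f z x + f z y).

Definition mult4 S :=
  (forall z w, bilin (fun x y => S x y z w)) /\ (forall x y, bilin (S x y)).

Lemma bilinDl f : bilin f -> forall x y z, f (x + y) z = f x z + f y z.
Proof. by case=> h _ x y z; have := h 1 x y z; rewrite scale1r mul1r. Qed.
Lemma bilinDr f : bilin f -> forall x y z, f z (x + y) = f z x + f z y.
Proof. by case=> _ h x y z; have := h 1 x y z; rewrite scale1r mul1r. Qed.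
Lemma bilin0l f : bilin f -> forall z, f 0 z = 0.
Proof. by move=> h z; have := bilinDl h 0 0 z; rewrite addr0; lra. Qed.
Lemma bilin0r f : bilin f -> forall z, f z 0 = 0.
Proof. by move=> h z; have := bilinDr h 0 0 z; rewrite addr0; lra. Qed.
Lemma bilinZl f : bilin f -> forall a x z, f (a *: x) z = a * f x z.
Proof. by move=> h a x z; rewrite -[a *: x]addr0 h.1 bilin0l // addr0. Qed.
Lemma bilinZr f : bilin f -> forall a x z, f z (a *: x) = a * f z x.
Proof. by move=> h a x z; rewrite -[a *: x]addr0 h.2 bilin0r // addr0. Qed.
Lemma bilinNl f : bilin f -> forall x z, f (- x) z = - f x z.
Proof. by move=> h x z; rewrite -scaleN1r bilinZl // mulN1r. Qed.
Lemma bilin_comb f g a b :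
  bilin f -> bilin g -> bilin (fun x y => a * f x y + b * g x y).
Proof.
by move=> hf hg; split=> k x y z; rewrite ?hf.1 ?hg.1 ?hf.2 ?hg.2; ring.
Qed.

Lemma bilinZ f a : bilin f -> bilin (fun x y => a * f x y).
Proof. by move=> hf; split=> k x y z; rewrite ?hf.1 ?hf.2; ring. Qed.

Lemma bilin_swap f : bilin f -> bilin (fun x y => f y x).
Proof. by case=> h1 h2; split=> *; rewrite ?h1 ?h2. Qed.

Lemma bilin_sum n (F : 'I_n -> V -> V -> R) :
  (forall k, bilin (F k)) -> bilin (fun x y => \sum_k F k x y).
Proof.
move=> h; split=> a x y z; rewrite mulr_sumr -big_split; apply: eq_bigr => k _.
  exact: (h k).1.
exact: (h k).2.
Qed.

Lemma homP (u : 'Hom(V, R^o)) a x y : u (a *: x + y) = a * u x + u y :> R.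
Proof. by rewrite linearP. Qed.

Lemma bilin_prod (u v : 'Hom(V, R^o)) : bilin (fun x y => u x * v y).
Proof. by split=> a x y z; rewrite homP ?mulrDl ?mulrDr ?mulrA // [_ * a]mulrC. Qed.

Lemma mult4D S X a b : mult4 S -> mult4 X ->
  mult4 (fun x y z w => a * S x y z w + b * X x y z w).
Proof.
move=> [s1 s2] [x1 x2]; split=> x y.
  exact: (bilin_comb a b (s1 x y) (x1 x y)).
exact: (bilin_comb a b (s2 x y) (x2 x y)).
Qed.

Lemma mult4_prod f g : bilin f -> bilin g -> mult4 (fun x y z w => f x y * g z w).
Proof.
move=> hf hg; split=> x y; split=> a u v z; rewrite ?hf.1 ?hg.1 ?hf.2 ?hg.2; ring.
Qed.

Lemma mult4_sum n (F : 'I_n -> V -> V -> V -> V -> R) :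
  (forall k, mult4 (F k)) -> mult4 (fun x y z w => \sum_k F k x y z w).
Proof.
move=> h; split=> x y.
  by apply: (bilin_sum (F := fun k u v => F k u v x y)) => k; exact: (h k).1.
by apply: (bilin_sum (F := fun k => F k x y)) => k; exact: (h k).2.
Qed.

(* Elements of V (x) V are represented by lists of pairs, standing for the sum of
   the corresponding pure tensors. *)
Definition ev2 f s : R := \sum_(p <- s) f p.1 p.2.
Definition ev S s t : R := \sum_(p <- s) ev2 (S p.1 p.2) t.

Definition scal (a : R) s := [seq (a *: p.1, p.2) | p <- s].

Lemma ev2_cat f s t : ev2 f (s ++ t) = ev2 f s + ev2 f t.
Proof. exact: big_cat. Qed.

Lemma ev2_scal f a s : bilin f -> ev2 f (scal a s) = a * ev2 f s.
Proof.
by move=> h; rewrite /ev2 big_map mulr_sumr; apply: eq_bigr => p _; rewrite bilinZl.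
Qed.

Lemma ev2_comb f g a b s :
  ev2 (fun x y => a * f x y + b * g x y) s = a * ev2 f s + b * ev2 g s.
Proof. by rewrite /ev2 !mulr_sumr -big_split. Qed.

Lemma ev2_sum n (F : 'I_n -> V -> V -> R) s :
  ev2 (fun x y => \sum_k F k x y) s = \sum_k ev2 (F k) s.
Proof. by rewrite /ev2 exchange_big. Qed.

Lemma ev2_mull f a s : ev2 (fun x y => a * f x y) s = a * ev2 f s.
Proof. by rewrite /ev2 mulr_sumr. Qed.

Lemma evC S s t : (forall a b c d, S c d a b = S a b c d) -> ev S s t = ev S t s.
Proof.
move=> h; rewrite /ev /ev2 exchange_big; apply: eq_bigr => p _.
by apply: eq_bigr => q _; rewrite h.
Qed.

Lemma ev_catl S s t u : ev S (s ++ t) u = ev S s u + ev S t u.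
Proof. exact: big_cat. Qed.
Lemma ev_catr S s t u : ev S u (s ++ t) = ev S u s + ev S u t.
Proof. by rewrite /ev -big_split; apply: eq_bigr => p _; rewrite ev2_cat. Qed.
Lemma ev_scall S a s u : mult4 S -> ev S (scal a s) u = a * ev S s u.
Proof.
move=> h; rewrite /ev big_map mulr_sumr; apply: eq_bigr => p _ /=.
rewrite /ev2 mulr_sumr; apply: eq_bigr => q _; exact: (bilinZl (h.1 _ _)).
Qed.
Lemma ev_scalr S a s u : mult4 S -> ev S u (scal a s) = a * ev S u s.
Proof.
move=> h; rewrite /ev mulr_sumr; apply: eq_bigr => p _ /=.
exact: ev2_scal (h.2 _ _).
Qed.

Lemma ev_comb S X a b s t :
  ev (fun x y z w => a * S x y z w + b * X x y z w) s t = a * ev S s t + b * ev X s t.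
Proof.
by rewrite /ev !mulr_sumr -big_split; apply: eq_bigr => p _; exact: ev2_comb.
Qed.

Lemma ev_prod f g s t : ev (fun x y z w => f x y * g z w) s t = ev2 f s * ev2 g t.
Proof. by rewrite /ev {2}/ev2 mulr_suml; apply: eq_bigr => p _; rewrite ev2_mull. Qed.

Lemma ev_sum n (F : 'I_n -> V -> V -> V -> V -> R) s t :
  ev (fun x y z w => \sum_k F k x y z w) s t = \sum_k ev (F k) s t.
Proof.
rewrite /ev [RHS]exchange_big; apply: eq_bigr => p _ /=.
exact: (ev2_sum (fun k => F k p.1 p.2)).
Qed.

Lemma ev_gram n (T : 'I_n -> V -> V -> R) s t :
  ev (fun x y z w => \sum_k T k x y * T k z w) s t = \sum_k ev2 (T k) s * ev2 (T k) t.
Proof.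
rewrite (ev_sum (fun k x y z w => T k x y * T k z w)).
by apply: eq_bigr => k _; rewrite ev_prod.
Qed.

Lemma ev_seq1 S x y z w : ev S [:: (x, y)] [:: (z, w)] = S x y z w.
Proof. by rewrite /ev /ev2 !big_seq1. Qed.

Lemma ev2_seq1 f x y : ev2 f [:: (x, y)] = f x y.
Proof. by rewrite /ev2 !big_seq1. Qed.

Lemma psd_ev S : psd S <-> forall s, 0 <= ev S s s.
Proof.
split=> [h s|h n a b].
  have := h (size s) (fun i => (tnth (in_tuple s) i).1) (fun i => (tnth (in_tuple s) i).2).
  rewrite /ev (big_tnth _ _ s) => /le_trans; apply; rewrite le_eqVlt; apply/orP; left; apply/eqP.
  by apply: eq_bigr => i _; rewrite /ev2 (big_tnth _ _ s).
have := h [seq (a i, b i) | i <- enum 'I_n].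
rewrite /ev big_map big_enum /= => /le_trans; apply; rewrite le_eqVlt; apply/orP; left; apply/eqP.
by apply: eq_bigr => i _; rewrite /ev2 big_map big_enum.
Qed.

Definition sym4 S := forall a b c d, S c d a b = S a b c d.

Definition psdform S := [/\ mult4 S, sym4 S & forall s, 0 <= ev S s s].

Lemma psd_cauchy S s t : psdform S -> ev S s t ^+ 2 <= ev S s s * ev S t t.
Proof.
case=> m sy p; apply: quadratic_discr_le => a.
have := p (scal a s ++ t).
rewrite !ev_catl !ev_catr !ev_scall // !ev_scalr // (evC t s sy).
by move=> /le_trans; apply; rewrite le_eqVlt; apply/orP; left; apply/eqP; ring.
Qed.

Lemma psd_ker S s t : psdform S -> ev S s s = 0 -> ev S s t = 0.
Proof.
move=> p h; have := psd_cauchy s t p; rewrite h mul0r => h2.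
by apply/eqP; rewrite -sqrf_eq0 eq_le h2 sqr_ge0.
Qed.

(* [L] detects bilinear forms, for instance the pairs from a basis of [V]. *)
Definition detects (L : seq (V * V)) :=
  forall f, bilin f -> (forall p, p \in L -> f p.1 p.2 = 0) -> forall x y, f x y = 0.

Definition indep n (T : 'I_n -> V -> V -> R) :=
  forall c : 'I_n -> R, (forall x y, \sum_k c k * T k x y = 0) -> forall k, c k = 0.

(** Symmetric elimination: a pivot (u, v) in [L] with S(u,v,u,v) > 0 gives T0 = S(u,v, . , . ) /
    sqrt S(u,v,u,v), and S - T0 (x) T0 stays positive by Cauchy-Schwarz. Null pairs stay null and
    the pivot becomes null, so the number of non-null pairs of [L] decreases. Taking [eps] to be 1
    or -1 serves the symmetric and the alternating part at once. *)
Lemma gram_decomposition (L : seq (V * V)) (eps : R) S : detects L -> psdform S ->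
  (forall x y z w, S x y w z = eps * S x y z w) ->
  exists n (T : 'I_n -> V -> V -> R),
    [/\ forall k, bilin (T k), forall k x y, T k y x = eps * T k x y, indep T &
        forall x y z w, S x y z w = \sum_k T k x y * T k z w].
Proof.
move=> dL; have [m le_m] := ubnP (count (fun p => S p.1 p.2 p.1 p.2 != 0) L).
elim: m S le_m => [//|m IH] S le_m pS par; have [mS sS nS] := pS.
have [/hasP[[u v] uvL /= nz]|/hasPn all0] :=
    boolP (has (fun p => S p.1 p.2 p.1 p.2 != 0) L); last first.
  exists 0%N, (fun _ _ _ => 0); split=> [k|k|c _ k|x y z w]; try by case: k.
  rewrite big_ord0; apply: (dL (fun x y => S x y z w)); first exact: mS.1.
  move=> p /all0; rewrite negbK => /eqP h.
  have := @psd_ker S [:: (p.1, p.2)] [:: (z, w)] pS; rewrite !ev_seq1; exact.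
have Apos : 0 < S u v u v.
  by rewrite lt_def nz -ev_seq1 nS.
set A := S u v u v in nz Apos.
pose r := Num.sqrt A.
have rr : r ^+ 2 = A by rewrite sqr_sqrtr // ltW.
have r0 : r != 0 by rewrite sqrtr_eq0 -ltNge.
pose T0 x y := r^-1 * S u v x y.
have bT0 : bilin T0 by apply: bilinZ; exact: mS.2.
pose S' x y z w := 1 * S x y z w + (-1) * (T0 x y * T0 z w).
have S'E x y z w : S' x y z w = S x y z w - T0 x y * T0 z w.
  by rewrite /S'; ring.
have pS' : psdform S'.
  split; first by apply: mult4D => //; apply: mult4_prod.
    by move=> a b c d; rewrite !S'E sS; ring.
  move=> s; rewrite ev_comb ev_prod mul1r mulN1r subr_ge0 /T0 !ev2_mull.
  have := psd_cauchy [:: (u, v)] s pS.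
  rewrite ev_seq1 {1 2}/ev big_seq1 /= -/A => h.
  rewrite mulrACA -invfM -!expr2 rr mulrC ler_pdivrMr //.
  by rewrite mulrC.
have par' x y z w : S' x y w z = eps * S' x y z w.
  by rewrite !S'E /T0 (par x y z w) (par u v z w); ring.
have S'uv z w : S' u v z w = 0.
  by rewrite S'E /T0 -/A -rr; field.
have cnt : (count (fun p => S' p.1 p.2 p.1 p.2 != 0%R) L < m)%N.
  apply: (@leq_trans (count (fun p => S p.1 p.2 p.1 p.2 != 0%R) L)); last first.
    by rewrite -ltnS.
  have sub p : S' p.1 p.2 p.1 p.2 != 0 -> S p.1 p.2 p.1 p.2 != 0.
    apply: contra => /eqP h.
    have k : forall z w, S p.1 p.2 z w = 0.
      move=> z w; have := @psd_ker S [:: (p.1, p.2)] [:: (z, w)] pS.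
      by rewrite !ev_seq1; exact.
    by rewrite S'E /T0 -!(sS u v) !k; apply/eqP; ring.
  elim: {dL IH le_m} L uvL => // p L IHL; rewrite inE => /orP[/eqP<-|/IHL h] /=.
    by rewrite S'uv eqxx /= nz ltnS sub_count.
  have := sub p; case: (S' _ _ _ _ != 0); case: (S _ _ _ _ != 0) => //=.
    by move=> /(_ isT).
  by move=> _; exact: leqW.
have [n [T [bT pT iT ST]]] := IH S' cnt pS' par'.
(* The remainder vanishes at the pivot, hence so does each of its squares; [T0] does not, which
   gives independence. *)
have Tuv k : T k u v = 0.
  have := S'uv u v; rewrite ST => /eqP; rewrite psumr_eq0; last first.
    by move=> i _; rewrite -expr2 sqr_ge0.
  by move=> /allP/(_ k); rewrite mem_index_enum mulf_eq0 orbb => /(_ isT)/eqP.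
exists n.+1, (fun k => if unlift ord0 k is Some j then T j else T0); split.
- by move=> k; case: unlift.
- by move=> k x y; case: unlift => [j|]; [exact: pT | rewrite /T0 (par u v x y); ring].
- move=> c hc.
  have hc' x y : c ord0 * T0 x y + \sum_k c (lift ord0 k) * T k x y = 0.
    have := hc x y; rewrite big_ord_recl unlift_none => h; rewrite -[RHS]h; congr (_ + _).
    by apply: eq_bigr => k _; rewrite liftK.
  have c0 : c ord0 = 0.
    have := hc' u v; rewrite big1 ?addr0; last by move=> k _; rewrite Tuv mulr0.
    rewrite /T0 -/A -rr => /eqP; rewrite mulf_eq0 => /orP[/eqP//|].
    by rewrite mulf_eq0 invr_eq0 expf_eq0 /= (negbTE r0).
  move=> k; case: (unliftP ord0 k) => [j ->|-> //].
  apply: (iT (fun j => c (lift ord0 j))) => x y.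
  by have := hc' x y; rewrite c0 mul0r add0r.
- move=> x y z w; rewrite big_ord_recl unlift_none.
  have -> : S x y z w = T0 x y * T0 z w + S' x y z w by rewrite S'E; ring.
  by rewrite ST; congr (_ + _); apply: eq_bigr => k _; rewrite liftK.
Qed.

End Forms.

(** * Expansion of the totally symmetric product over the 24 permutations *)

Lemma sum_perm4 (R : nmodType) (F : 'I_4 -> 'I_4 -> 'I_4 -> 'I_4 -> R) :
  \sum_(s : 'S_4) F (s 0) (s 1) (s 2) (s 3) =
  \sum_(i < 4) \sum_(j < 4) \sum_(k < 4) \sum_(l < 4)
    (if uniq [:: i; j; k; l] then F i j k l else 0).
Proof.
rewrite pair_bigA pair_bigA pair_bigA /=.
pose g (s : 'S_4) := (s 0, s 1, s 2, s 3).
(* The inverse of [g] on quadruples without repetition; the default 1 is arbitrary. *)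
pose q (t : 'I_4 * 'I_4 * 'I_4 * 'I_4) : 'S_4 :=
  if insub [ffun i : 'I_4 => nth 0 [:: t.1.1.1; t.1.1.2; t.1.2; t.2] i] is Some s then s else 1%g.
rewrite -big_mkcond /= (reindex_onto g q) /=.
  apply: eq_bigl => s; apply/esym/andP; split.
    rewrite /= !inE !(inj_eq perm_inj) //=.
  rewrite /q.
  have -> : [ffun i0 : 'I_4 => nth 0 [:: (g s).1.1.1; (g s).1.1.2; (g s).1.2; (g s).2] i0] = pval s.
    apply/ffunP => j; rewrite ffunE pvalE /=.
    case: j => [[|[|[|[|//]]]] lj] /=; congr (s _); exact: val_inj.
  by rewrite valK.
case=> [[[i j] k] l] /= u.
have inj : injectiveb [ffun m : 'I_4 => nth 0 [:: i; j; k; l] m].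
  apply/injectiveP => m m'; rewrite !ffunE => /eqP.
  by rewrite (nth_uniq 0) ?u //=; move=> /eqP/val_inj.
have E m : q (i, j, k, l) m = nth 0 [:: i; j; k; l] m.
  by rewrite /q insubT -pvalE SubK ffunE.
by rewrite /g !E.
Qed.

Lemma sum_ord4 (R : nmodType) (F : 'I_4 -> R) :
  \sum_(i < 4) F i =
  F (@Ordinal 4 0 isT) + F (@Ordinal 4 1 isT) + F (@Ordinal 4 2 isT) + F (@Ordinal 4 3 isT).
Proof.
rewrite !big_ord_recr big_ord0 /= add0r.
by congr (F _ + F _ + F _ + F _); apply: val_inj.
Qed.

Section Tensors.
Variables (R : realType) (V : vectType R).
Implicit Types (f g : V -> V -> R) (S X : V -> V -> V -> V -> R) (s t : seq (V * V)).

Lemma sprod4E (b1 b2 b3 b4 : 'Hom(V, R^o)) (x y z w : V) :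
  let p u1 u2 u3 u4 := (u1 x * u2 y * (u3 z * u4 w) : R) in
  sprod4 b1 b2 b3 b4 x y z w = 24^-1 *
   (p b1 b2 b3 b4 + p b1 b2 b4 b3 + p b1 b3 b2 b4 + p b1 b3 b4 b2 + p b1 b4 b2 b3 + p b1 b4 b3 b2
  + p b2 b1 b3 b4 + p b2 b1 b4 b3 + p b2 b3 b1 b4 + p b2 b3 b4 b1 + p b2 b4 b1 b3 + p b2 b4 b3 b1
  + p b3 b1 b2 b4 + p b3 b1 b4 b2 + p b3 b2 b1 b4 + p b3 b2 b4 b1 + p b3 b4 b1 b2 + p b3 b4 b2 b1
  + p b4 b1 b2 b3 + p b4 b1 b3 b2 + p b4 b2 b1 b3 + p b4 b2 b3 b1 + p b4 b3 b1 b2 + p b4 b3 b2 b1).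
Proof.
move=> p; rewrite /sprod4 (_ : 4`! = 24%N) //=.
set b := tnth _.
have -> : (24%:R^-1 *: (\sum_(s : 'S_4) otimes2 (otimes (b (s 0)) (b (s 1)))
   (otimes (b (s 2)) (b (s 3))))) x y z w =
   24^-1 * \sum_(s : 'S_4) p (b (s 0)) (b (s 1)) (b (s 2)) (b (s 3)).
  rewrite !fctE /= -[LHS]/(_ * _); congr (_ * _).
  by elim/big_rec2: _ => // s u v _; rewrite !fctE => ->.
congr (_ * _); rewrite (sum_perm4 (fun i j k l => p (b i) (b j) (b k) (b l))).
rewrite sum_ord4 !sum_ord4 /= !add0r !addr0 /b /=.
rewrite !(tnth_nth b1) /=; ring.
Qed.
End Tensors.

(** * The cone, its perturbations and the range of its elements *)

Section Cone.
Variables (R : realType) (V : vectType R).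
Implicit Types (f g : V -> V -> R) (S X : V -> V -> V -> V -> R) (s t : seq (V * V)).
Implicit Types (a b : 'Hom(V, R^o)).

Lemma tensor4P S X : (forall x y z w, S x y z w = X x y z w) -> S = X.
Proof.
by move=> h; apply/funext => x; apply/funext => y; apply/funext => z; apply/funext => w.
Qed.

Lemma multilinear4P S : multilinear4 S <-> mult4 S.
Proof.
split=> [[h1 h2 h3 h4]|h].
  split=> u v; split=> k x y z.
  - exact: h1.
  - exact: h2.
  - exact: h3.
  - exact: h4.
split=> x y z k u v.
- exact: (h.1 y z).1.
- exact: (h.1 y z).2.
- exact: (h.2 x y).1.
- exact: (h.2 x y).2.
Qed.

(** The slot permutations (13) and (12)(34) generate the dihedral group of order 8 of all symmetries
    of an element of W; the splitting into two summands then comes for free. *)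
Definition Wsym S := [/\ mult4 S, forall x y z w, S z y x w = S x y z w &
  forall x y z w, S y x w z = S x y z w].

Definition symp S x y z w : R := 2^-1 * S x y z w + 2^-1 * S y x z w.
Definition altp S x y z w : R := 2^-1 * S x y z w + (- 2^-1) * S y x z w.

Section Wsym_theory.
Variables (S : V -> V -> V -> V -> R) (WS : Wsym S).

Lemma Wsym24 x y z w : S x w z y = S x y z w.
Proof. by case: WS => _ h1 h2; rewrite h2 h1 h2. Qed.

Lemma Wsym_sym4 : sym4 S.
Proof. by move=> x y z w; case: (WS) => _ h1 h2; rewrite h1 Wsym24. Qed.

Lemma Wsym_swap x y z w : S y x z w = S x y w z.
Proof. by case: WS => _ _ h; rewrite h. Qed.

Lemma symp_mult4 : mult4 (symp S).
Proof.
case: WS => m _ _; split=> x y; first exact: bilin_comb (m.1 x y) (bilin_swap (m.1 x y)).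
exact: bilin_comb (m.2 x y) (m.2 y x).
Qed.

Lemma altp_mult4 : mult4 (altp S).
Proof.
case: WS => m _ _; split=> x y; first exact: bilin_comb (m.1 x y) (bilin_swap (m.1 x y)).
exact: bilin_comb (m.2 x y) (m.2 y x).
Qed.

Lemma symp_sym4 : sym4 (symp S).
Proof.
by move=> x y z w; rewrite /symp (Wsym_sym4 x y z w) (Wsym_sym4 x y w z) (Wsym_swap x y z w).
Qed.
Lemma altp_sym4 : sym4 (altp S).
Proof.
by move=> x y z w; rewrite /altp (Wsym_sym4 x y z w) (Wsym_sym4 x y w z) (Wsym_swap x y z w).
Qed.
Lemma sympC x y z w : symp S x y w z = symp S x y z w.
Proof. by rewrite /symp -(Wsym_swap x y z w) (Wsym_swap x y w z); ring. Qed.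
Lemma altpC x y z w : altp S x y w z = - altp S x y z w.
Proof. by rewrite /altp -(Wsym_swap x y z w) (Wsym_swap x y w z); ring. Qed.
Lemma sympCl x y z w : symp S y x z w = symp S x y z w.
Proof. by rewrite /symp; ring. Qed.
Lemma altpCl x y z w : altp S y x z w = - altp S x y z w.
Proof. by rewrite /altp; ring. Qed.
Lemma symp_altp x y z w : S x y z w = symp S x y z w + altp S x y z w.
Proof. by rewrite /symp /altp; field. Qed.

(* The curvature part of a Gram matrix of a quartic: for [symp S = q (x) q] this
   says that [altp S] is minus the adjugate of [q]. *)
Lemma altp_symp x y z w : altp S x z y w = symp S x w z y - symp S x y z w.
Proof.
case: (WS) => _ h1 h2; rewrite /altp /symp (Wsym24 x y z w) (h2 x w y z).
by rewrite (Wsym24 x z y w) (h1 y x z w); ring.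
Qed.

End Wsym_theory.

Lemma W_Wsym S : W S <-> Wsym S.
Proof.
split=> [[[S1 [S2 [[m1 p1 p2 p3] [m2 q1 q2 q3] ->]]] tS]|WS].
  set T := S1 + S2 in tS *.
  have TE x y z w : T x y z w = S1 x y z w + S2 x y z w by [].
  have t24 x y z w : T x w z y = T x y z w.
    by rewrite -[LHS]/(tau T x y z w) tS.
  have s x y z w : T z w x y = T x y z w by rewrite !TE p3 q3.
  split; last by move=> x y z w; rewrite !TE p1 p2 q1 q2 opprK.
    move: m1 m2 => /multilinear4P m1 /multilinear4P m2.
    have -> : T = (fun x y z w => 1 * S1 x y z w + 1 * S2 x y z w).
      by apply: tensor4P => x y z w; rewrite TE !mul1r.
    exact: mult4D.
  by move=> x y z w; rewrite s t24.
split; last by apply: tensor4P => x y z w; rewrite /tau (Wsym24 WS).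
exists (symp S), (altp S); split.
- split; first exact/multilinear4P/symp_mult4.
  + exact: sympCl.
  + exact: sympC.
  + exact: symp_sym4.
- split; first exact/multilinear4P/altp_mult4.
  + exact: altpCl.
  + exact: altpC.
  + exact: altp_sym4.
- by apply: tensor4P => x y z w; rewrite (symp_altp S).
Qed.

Lemma C_WP S : C_W S <-> Wsym S /\ forall s, 0 <= ev S s s.
Proof.
by split=> [[/W_Wsym h /psd_ev p]|[/W_Wsym h /psd_ev p]]; split.
Qed.

Lemma C_W_psdform S : C_W S -> psdform S.
Proof. by move=> /C_WP[h p]; split=> //; [case: h|exact: Wsym_sym4]. Qed.

Definition swap s := [seq (p.2, p.1) | p <- s].

Lemma ev2_swap f s : ev2 (fun x y => f y x) s = ev2 f (swap s).
Proof. by rewrite /ev2 big_map. Qed.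

Lemma ev_swap S s t : Wsym S -> ev S (swap s) (swap t) = ev S s t.
Proof.
case=> _ _ h; rewrite /ev /ev2 big_map; apply: eq_bigr => p _.
by rewrite big_map; apply: eq_bigr => q _; rewrite h.
Qed.

Lemma ev_swapl S s t : ev S (swap s) t = ev (fun x y => S y x) s t.
Proof. by rewrite /ev big_map. Qed.

(** Invariance under the swap gives 4 G(s, s) = S(s + s', s + s') with s' the transpose of s; the
    alternating part uses s - s' in the same way. *)
Lemma symp_psd S : C_W S -> psdform (symp S).
Proof.
move=> /C_WP[WS p]; split; [exact: symp_mult4|exact: symp_sym4|move=> s].
have := p (s ++ swap s).
rewrite !ev_catl !ev_catr ev_swap // (evC s (swap s) (Wsym_sym4 WS)) ev_swapl /symp.
rewrite (ev_comb S (fun x y => S y x)); lra.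
Qed.

Lemma altp_psd S : C_W S -> psdform (altp S).
Proof.
move=> /C_WP[WS p]; split; [exact: altp_mult4|exact: altp_sym4|move=> s].
have mS : mult4 S by case: WS.
have := p (s ++ scal (-1) (swap s)).
rewrite !ev_catl !ev_catr !ev_scall // !ev_scalr // ev_swap //.
rewrite (evC s (swap s) (Wsym_sym4 WS)) ev_swapl /altp.
rewrite (ev_comb S (fun x y => S y x)); lra.
Qed.

Lemma Wsym_comb S X k l : Wsym S -> Wsym X ->
  Wsym (fun x y z w => k * S x y z w + l * X x y z w).
Proof.
case=> s1 s2 s3 [x1 x2 x3]; split; first exact: mult4D.
  by move=> *; rewrite s2 x2.
by move=> *; rewrite s3 x3.
Qed.

(** If |X| <= c S, then S/2 + X/(2c) and S/2 - X/(2c) lie in the cone and add up to S. *)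
Lemma extremal_perturb S X C : extremal (@C_W R V) S -> Wsym X ->
  (forall s, `|ev X s s| <= C * ev S s s) -> exists r : R, forall x y z w, X x y z w = r * S x y z w.
Proof.
move=> [CS _ ext] WX bX; have [WS pS] := (C_WP S).1 CS.
pose c := `|C| + 1.
have c0 : 0 < c by rewrite ltr_wpDl.
have bX' s : `|ev X s s| <= c * ev S s s.
  apply: le_trans (bX s) _; rewrite ler_wpM2r //.
  by rewrite (le_trans (ler_norm _)) // /c lerDl.
pose Y e : V -> V -> V -> V -> R :=
  fun x y z w => 2^-1 * S x y z w + (e / (2 * c)) * X x y z w.
have CY e : e = 1 \/ e = -1 -> C_W (Y e).
  move=> he; apply/C_WP; split; first exact: Wsym_comb.
  move=> s; rewrite ev_comb.
  have -> : 2^-1 * ev S s s + e / (2 * c) * ev X s s = (c * ev S s s + e * ev X s s) / (2 * c).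
    by field; apply: lt0r_neq0.
  rewrite divr_ge0 //; last by rewrite mulr_ge0 // ltW.
  have := bX' s; rewrite ler_norml => /andP[h1 h2].
  by case: he => ->; rewrite ?mul1r ?mulN1r; lra.
have [] := ext (Y 1) (Y (-1)); [by apply: CY; left|by apply: CY; right| |].
  apply: tensor4P => x y z w.
  rewrite -[RHS]/(Y 1 x y z w + Y (-1) x y z w) /Y; field; exact: lt0r_neq0.
move=> [k _ hk] _; exists (c * (2 * k - 1)) => x y z w.
have : Y 1 x y z w = k * S x y z w by rewrite hk.
rewrite /Y => h.
have -> : c * (2 * k - 1) * S x y z w = 2 * c * (k * S x y z w) - c * S x y z w by ring.
rewrite -h; field; exact: lt0r_neq0.
Qed.

(* Equivalently, [f] lies in the range of [S]. *)
Definition dominated S f := bilin f /\ exists C, forall s, ev2 f s ^+ 2 <= C * ev S s s.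

Section Dominated.
Variables (S : V -> V -> V -> V -> R) (CS : C_W S).

Lemma dom_comb f g k l : dominated S f -> dominated S g -> dominated S (fun x y => k * f x y + l * g x y).
Proof.
case=> bf [C hC] [bg [D hD]]; split; first exact: bilin_comb.
exists (2 * k ^+ 2 * C + 2 * l ^+ 2 * D) => s; rewrite ev2_comb.
set u := ev2 f s; set v := ev2 g s.
have h1 := ler_wpM2l (sqr_ge0 k) (hC s); have h2 := ler_wpM2l (sqr_ge0 l) (hD s).
have := sqr_ge0 (k * u - l * v); rewrite -/u -/v in h1 h2; lra.
Qed.

Lemma domZ f k : dominated S f -> dominated S (fun x y => k * f x y).
Proof.
move=> h; have := dom_comb k 0 h h; congr (dominated S _).
by apply/funext => x; apply/funext => y; ring.
Qed.

Lemma dom_eq f g : (forall x y, f x y = g x y) -> dominated S f -> dominated S g.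
Proof. by move=> h; congr (dominated S _); apply/funext => x; apply/funext => y. Qed.

Lemma dom_swap f : dominated S f -> dominated S (fun x y => f y x).
Proof.
case=> bf [C hC]; split; first exact: bilin_swap.
exists C => s; rewrite ev2_swap -(@ev_swap S s s); first exact: hC.
by case: ((C_WP S).1 CS).
Qed.

Lemma dom_self x y : dominated S (S x y).
Proof.
have pS := C_W_psdform CS; split; first by case: pS => m _ _; exact: m.2.
exists (S x y x y) => s; have := psd_cauchy [:: (x, y)] s pS.
by rewrite ev_seq1 {1}/ev big_seq1.
Qed.

Lemma dom_symp x y : dominated S (symp S x y).
Proof. exact: dom_comb (dom_self x y) (dom_self y x). Qed.
Lemma dom_altp x y : dominated S (altp S x y).
Proof. exact: dom_comb (dom_self x y) (dom_self y x). Qed.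

Lemma dom_gram n (T : 'I_n -> V -> V -> R) : (forall k, bilin (T k)) ->
  (forall s, \sum_k ev2 (T k) s ^+ 2 <= ev S s s) -> forall k, dominated S (T k).
Proof.
move=> bT h k; split=> //; exists 1 => s; rewrite mul1r; apply: le_trans (h s).
by rewrite (bigD1 k) //= lerDl sumr_ge0 // => i _; exact: sqr_ge0.
Qed.

End Dominated.

Definition type12 S :=
  (exists2 a : 'Hom(V, R^o), a != 0 & S = sprod4 a a a a) \/
  exists a1 a2 : 'Hom(V, R^o), free [:: a1; a2] /\
    S = otimes2 (vee a1 a2) (vee a1 a2) + otimes2 (wedge a1 a2) (wedge a1 a2).

Lemma type1E a x y z w : sprod4 a a a a x y z w = a x * a y * (a z * a w) :> R.
Proof. by rewrite sprod4E; field. Qed.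

Lemma type2E a b x y z w :
  (otimes2 (vee a b) (vee a b) + otimes2 (wedge a b) (wedge a b)) x y z w =
  2^-1 * (a x * b y * (a z * b w) + b x * a y * (b z * a w)) :> R.
Proof.
have v u u' : vee a b u u' = 2^-1 * (a u * b u' + b u * a u') :> R by [].
have d u u' : wedge a b u u' = 2^-1 * (a u * b u' - b u * a u') :> R by [].
rewrite -[LHS]/((vee a b x y : R) * vee a b z w + (wedge a b x y : R) * wedge a b z w).
by rewrite !v !d; field.
Qed.

Lemma homZ (k : R) a x : (k *: a) x = k * a x :> R.
Proof. by rewrite scale_lfunE. Qed.

Lemma hom_neq0 a : a != 0 -> exists v, a v = 1 :> R.
Proof.
move=> a0; have [v av] : exists v, (a v : R) != 0.
  apply: contrapT => h; move/eqP: a0; apply; apply/lfunP => v; rewrite lfunE /=.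
  by apply: contrapT => /eqP ?; apply: h; exists v.
exists ((a v : R)^-1 *: v).
by rewrite linearZ -[LHS]/((a v : R)^-1 * a v) mulVf.
Qed.

Lemma hom_free2 a b : b != 0 -> ~~ free [:: a; b] -> exists k : R, a = k *: b.
Proof.
move=> b0; rewrite free_cons span_seq1 seq1_free b0 andbT negbK => /vlineP[k ->].
by exists k.
Qed.

(* A small multiple of [(a (x) b)^2 + (b (x) a)^2] can be subtracted from [S]. *)
Lemma dom_product_type S a b : extremal (@C_W R V) S -> a != 0 -> b != 0 ->
  dominated S (fun x y => a x * b y) -> type12 S.
Proof.
move=> ext a0 b0 dab; have [CS _ _] := ext; have [WS pS] := (C_WP S).1 CS.
have dba : dominated S (fun x y => b x * a y).
  by apply: dom_eq (dom_swap CS dab) => x y; rewrite mulrC.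
pose X x y z w : R := 1 * (a x * b y * (a z * b w)) + 1 * (b x * a y * (b z * a w)).
have XE x y z w : X x y z w = a x * b y * (a z * b w) + b x * a y * (b z * a w).
  by rewrite /X !mul1r.
have WX : Wsym X.
  split; last 2 first.
  - by move=> *; rewrite !XE; ring.
  - by move=> *; rewrite !XE; ring.
  by apply: mult4D; apply: mult4_prod; exact: bilin_prod.
have [_ [C hC]] := dab; have [_ [D hD]] := dba.
have [|t ht] := @extremal_perturb S X (C + D) ext WX.
  move=> s; rewrite (ev_comb (fun x y z w => a x * b y * (a z * b w))
    (fun x y z w => b x * a y * (b z * a w))).
  rewrite (ev_prod (fun x y => a x * b y) (fun x y => a x * b y)).
  rewrite (ev_prod (fun x y => b x * a y) (fun x y => b x * a y)).
  rewrite !mul1r -!expr2 ger0_norm ?addr_ge0 ?sqr_ge0 //.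
  by rewrite mulrDl lerD.
have [v av] := hom_neq0 a0; have [u bu] := hom_neq0 b0.
have t0 : 0 < t.
  have : 0 < X v u v u.
    by rewrite XE av bu; have := sqr_ge0 (b v * a u : R); lra.
  rewrite ht; have := pS [:: (v, u)]; rewrite ev_seq1 le_eqVlt => /orP[/eqP<-|h].
    by rewrite mulr0 ltxx.
  by rewrite pmulr_lgt0.
have SE x y z w : S x y z w = t^-1 * (a x * b y * (a z * b w) + b x * a y * (b z * a w)).
  by rewrite -XE ht mulKf // gt_eqF.
(* For independent factors, scaling [a] by sqrt (2/t) turns 1/t into the 1/2 of [type2E]. If a = k
   b, the two squares coincide and b is scaled by the fourth root of 2 k^2 / t. *)
have [fab|/(hom_free2 b0)[k abk]] := boolP (free [:: a; b]).
  right; pose r := Num.sqrt (2 * t^-1).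
  have r0 : 0 < r by rewrite sqrtr_gt0 mulr_gt0 // invr_gt0.
  have rr : r ^+ 2 = 2 * t^-1 by rewrite sqr_sqrtr // mulr_ge0 // ltW // invr_gt0.
  exists (r *: a), b; split.
    move: fab; rewrite !free_cons !span_seq1; case/andP => ab ->; rewrite andbT.
    apply: contra ab => h; have := memvZ r^-1 h; rewrite scalerA mulVf ?scale1r //.
    exact: lt0r_neq0.
  apply: tensor4P => x y z w; rewrite type2E !homZ SE.
  have -> : t^-1 = 2^-1 * r ^+ 2 by rewrite rr; field; exact: lt0r_neq0.
  by field.
left; pose r := Num.sqrt (Num.sqrt (2 * t^-1 * k ^+ 2)).
have k0 : k != 0 by apply: contra a0 => /eqP k0; rewrite abk k0 scale0r.
have p0 : 0 < 2 * t^-1 * k ^+ 2.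
  by rewrite mulr_gt0 ?exprn_even_gt0 // mulr_gt0 // invr_gt0.
have r0 : 0 < r by rewrite !sqrtr_gt0.
have rr : r ^+ 2 ^+ 2 = 2 * t^-1 * k ^+ 2.
  by rewrite /r !sqr_sqrtr // ?sqrtr_ge0 // ltW.
exists (r *: b); first by rewrite scaler_eq0 negb_or b0 andbT gt_eqF.
apply: tensor4P => x y z w; rewrite type1E !homZ SE abk !homZ.
have -> : r * b x * (r * b y) * (r * b z * (r * b w)) =
  r ^+ 2 ^+ 2 * (b x * b y * (b z * b w)) :> R by ring.
by rewrite rr; ring.
Qed.

End Cone.

Lemma li3_free_gen (R : fieldType) (U : vectType R) (e1 e2 e3 : U) :
  (forall k l m : R, k *: e1 + l *: e2 + m *: e3 = 0 -> [/\ k = 0, l = 0 & m = 0]) ->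
  free [:: e1; e2; e3].
Proof.
move=> h; apply/(@freeP _ _ _ [tuple e1; e2; e3]) => k.
rewrite !big_ord_recl big_ord0 addr0 /= addrA => /h[k0 k1 k2].
by case=> [[|[|[|//]]] lt]; [rewrite -[RHS]k0|rewrite -[RHS]k1|rewrite -[RHS]k2];
  congr (k _); apply: val_inj.
Qed.

(** * Bases of V and dual bases in dimension three *)

Section Bases.
Variables (R : realType) (V : vectType R).
Implicit Types (f g : V -> V -> R) (S X : V -> V -> V -> V -> R) (s t : seq (V * V)).
Implicit Types (a b : 'Hom(V, R^o)) (x y z e : V).

Definition dual3 e1 e2 e3 a1 a2 a3 : Prop :=
  [/\ forall x, x = (a1 x : R) *: e1 + (a2 x : R) *: e2 + (a3 x : R) *: e3,
      [/\ a1 e1 = 1 :> R, a1 e2 = 0 :> R & a1 e3 = 0 :> R],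
      [/\ a2 e1 = 0 :> R, a2 e2 = 1 :> R & a2 e3 = 0 :> R] &
      [/\ a3 e1 = 0 :> R, a3 e2 = 0 :> R & a3 e3 = 1 :> R]].

Definition li3 e1 e2 e3 := forall k l m : R,
  k *: e1 + l *: e2 + m *: e3 = 0 -> [/\ k = 0, l = 0 & m = 0].
Definition li2 e1 e2 := forall k l : R, k *: e1 + l *: e2 = 0 -> k = 0 /\ l = 0.

Lemma free_li3 e1 e2 e3 : free [:: e1; e2; e3] -> li3 e1 e2 e3.
Proof.
move=> /(@freeP _ _ _ [tuple e1; e2; e3]) h k l m E.
pose c (i : 'I_3) : R := nth 0 [:: k; l; m] i.
have H : forall i, c i = 0.
  by apply: h; rewrite !big_ord_recl big_ord0 addr0 /= addrA.
by split; [exact: (H (@Ordinal 3 0 isT))|exact: (H (@Ordinal 3 1 isT))|exact: (H (@Ordinal 3 2 isT))].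
Qed.

Lemma li3_free e1 e2 e3 : li3 e1 e2 e3 -> free [:: e1; e2; e3].
Proof. exact: li3_free_gen. Qed.

Lemma li2_free e1 e2 : li2 e1 e2 -> free [:: e1; e2].
Proof.
move=> h; apply/(@freeP _ _ _ [tuple e1; e2]) => k.
rewrite !big_ord_recl big_ord0 addr0 /= => /h[k0 k1].
by case=> [[|[|//]] lt]; [rewrite -[RHS]k0|rewrite -[RHS]k1]; congr (k _); apply: val_inj.
Qed.

Lemma li3C12 e1 e2 e3 : li3 e1 e2 e3 -> li3 e2 e1 e3.
Proof.
by move=> h k l m E; have [|-> -> ->] := h l k m; rewrite // -[RHS]E [l *: _ + _]addrC.
Qed.

Lemma li3C23 e1 e2 e3 : li3 e1 e2 e3 -> li3 e1 e3 e2.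
Proof.
by move=> h k l m E; have [|-> -> ->] := h k m l; rewrite // -[RHS]E addrAC.
Qed.

Lemma li3_add e1 e2 e3 (p q : R) : li3 e1 e2 e3 -> li3 e1 e2 (e3 + p *: e1 + q *: e2).
Proof.
move=> h k l m E; have [] := h (k + m * p) (l + m * q) m.
  rewrite -[RHS]E !scalerDl !scalerDr !scalerA.
  rewrite -!addrA; congr (_ + _); rewrite [LHS]addrCA; congr (_ + _).
  by rewrite [_ *: e2 + m *: e3]addrC addrCA.
by move=> h1 h2 m0; move: h1 h2; rewrite m0 !mul0r !addr0.
Qed.

Lemma li3_scale e1 e2 e3 (p q r : R) : p != 0 -> q != 0 -> r != 0 ->
  li3 e1 e2 e3 -> li3 (p *: e1) (q *: e2) (r *: e3).
Proof.
move=> p0 q0 r0 h k l m; rewrite !scalerA => /h[/eqP h1 /eqP h2 /eqP h3].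
move: h1 h2 h3; rewrite !mulf_eq0 (negbTE p0) (negbTE q0) (negbTE r0) !orbF.
by move=> /eqP-> /eqP-> /eqP->.
Qed.

Lemma li3_neq0 e1 e2 e3 : li3 e1 e2 e3 -> e1 != 0.
Proof.
move=> h; apply/eqP => e0; have [] := h 1 0 0; first by rewrite e0 !scale0r scaler0 !addr0.
by move=> /eqP; rewrite oner_eq0.
Qed.

Section ChangeOfBasis.
Variables (e1 e2 e3 : V) (a1 a2 a3 : 'Hom(V, R^o)) (D : dual3 e1 e2 e3 a1 a2 a3).

Lemma bilin_expand f x y : bilin f -> f x y =
  a1 x * a1 y * f e1 e1 + a1 x * a2 y * f e1 e2 + a1 x * a3 y * f e1 e3 +
  (a2 x * a1 y * f e2 e1 + a2 x * a2 y * f e2 e2 + a2 x * a3 y * f e2 e3) +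
  (a3 x * a1 y * f e3 e1 + a3 x * a2 y * f e3 e2 + a3 x * a3 y * f e3 e3) :> R.
Proof.
move=> bf; case: D => E _ _ _; rewrite {1}(E x) {1}(E y).
rewrite !(bilinDl bf) !(bilinZl bf) !(bilinDr bf) !(bilinZr bf); ring.
Qed.

Lemma sym_expand f x y : bilin f -> (forall x y, f y x = f x y) -> f x y =
  a1 x * a1 y * f e1 e1 + a2 x * a2 y * f e2 e2 + a3 x * a3 y * f e3 e3 +
  (a1 x * a2 y + a2 x * a1 y) * f e1 e2 + (a1 x * a3 y + a3 x * a1 y) * f e1 e3 +
  (a2 x * a3 y + a3 x * a2 y) * f e2 e3 :> R.
Proof.
by move=> bf s; rewrite (bilin_expand x y bf) (s e1 e2) (s e1 e3) (s e2 e3); ring.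
Qed.

Lemma alt_expand f x y : bilin f -> (forall x y, f y x = - f x y) -> f x y =
  (a1 x * a2 y - a2 x * a1 y) * f e1 e2 + (a1 x * a3 y - a3 x * a1 y) * f e1 e3 +
  (a2 x * a3 y - a3 x * a2 y) * f e2 e3 :> R.
Proof.
move=> bf s; rewrite (bilin_expand x y bf) (s e1 e2) (s e1 e3) (s e2 e3).
have z u : f u u = 0 by have := s u u; lra.
by rewrite !z; ring.
Qed.

End ChangeOfBasis.

Section Dim3.
Hypothesis dimV : \dim {:V} = 3%N.

Lemma extend_free (X : seq V) : free X -> (size X < 3)%N -> exists v, free (v :: X).
Proof.
move=> fX sX; have : ~~ ({:V} <= <<X>>)%VS.
  apply/negP => /dimvS; by rewrite dimV (eqP fX) leqNgt sX.
by move=> /subvPn[v _ vX]; exists v; rewrite free_cons vX.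
Qed.

Lemma extend_li2 e1 e2 : li2 e1 e2 -> exists e3, li3 e1 e2 e3.
Proof.
move=> /li2_free/extend_free[]// e3 f3; exists e3.
by apply: li3C23; apply: li3C12; exact: free_li3.
Qed.

Lemma extend_neq0 e1 : e1 != 0 -> exists e2 e3, li3 e1 e2 e3.
Proof.
move=> e0; have [|//|e2 f2] := @extend_free [:: e1]; first by rewrite seq1_free.
have [//|e3 f3] := @extend_free [:: e2; e1] f2; exists e2, e3.
by apply: li3C12; apply: li3C23; apply: li3C12; exact: free_li3.
Qed.

Lemma exists_li3 : exists e1 e2 e3, li3 e1 e2 e3.
Proof.
have [|//|e1 f1] := @extend_free [::]; first exact: nil_free.
have [|e2 [e3 h]] := @extend_neq0 e1; first by rewrite -seq1_free.
by exists e1, e2, e3.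
Qed.

Lemma hom_of_scalar (f : V -> R) : (forall k x y, f (k *: x + y) = k * f x + f y) ->
  exists u : 'Hom(V, R^o), forall x, u x = f x.
Proof.
move=> h; pose L : {linear V -> R^o} :=
  HB.pack (f : V -> R^o) (GRing.isLinear.Build R V R^o _ (f : V -> R^o) h).
by exists (linfun L) => x; rewrite lfunE.
Qed.

Lemma li3_dual e1 e2 e3 : li3 e1 e2 e3 -> exists a1 a2 a3, dual3 e1 e2 e3 a1 a2 a3.
Proof.
move=> /li3_free fr; pose X := [tuple e1; e2; e3].
have c (i : 'I_3) : exists u : 'Hom(V, R^o), forall x, u x = coord X i x.
  by apply: hom_of_scalar => k x y; rewrite linearP.
pose i1 := @Ordinal 3 0 isT; pose i2 := @Ordinal 3 1 isT; pose i3 := @Ordinal 3 2 isT.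
have [[a1 h1] [a2 h2] [a3 h3]] := And3 (c i1) (c i2) (c i3).
have E1 : e1 = X`_i1 by []. have E2 : e2 = X`_i2 by []. have E3 : e3 = X`_i3 by [].
exists a1, a2, a3; split.
- move=> x; have xs : x \in <<X>>%VS.
    suff -> : <<X>>%VS = {:V}%VS by exact: memvf.
    by apply/eqP; rewrite eqEdim subvf dimV (eqP fr).
  rewrite {1}(coord_span xs) !big_ord_recl big_ord0 addr0 addrA /= h1 h2 h3.
  by congr (coord X _ x *: _ + coord X _ x *: _ + coord X _ x *: _); apply: val_inj.
- by rewrite !h1 E1 E2 E3 !(coord_free _ _ fr).
- by rewrite !h2 E1 E2 E3 !(coord_free _ _ fr).
- by rewrite !h3 E1 E2 E3 !(coord_free _ _ fr).
Qed.

Lemma dual3_basis e1 e2 e3 a1 a2 a3 : dual3 e1 e2 e3 a1 a2 a3 ->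
  basis_of {:'Hom(V, R^o)} [:: a1; a2; a3].
Proof.
case=> E [h11 h12 h13] [h21 h22 h23] [h31 h32 h33].
have hE (k l m : R) x : (k *: a1 + l *: a2 + m *: a3) x = k * a1 x + l * a2 x + m * a3 x :> R.
  by rewrite !add_lfunE !scale_lfunE.
rewrite /basis_of; apply/andP; split.
  rewrite eqEsubv subvf /=; apply/subvP => u _.
  have -> : u = (u e1 : R) *: a1 + (u e2 : R) *: a2 + (u e3 : R) *: a3.
    apply/lfunP => x; rewrite hE {1}(E x) -addrA !homP.
    have -> : u ((a3 x : R) *: e3) = (a3 x : R) * u e3 :> R by rewrite linearZ.
    by rewrite addrA [_ * a1 x]mulrC [_ * a2 x]mulrC [_ * a3 x]mulrC.
  by rewrite !rpredD // rpredZ // memv_span // !inE eqxx ?orbT.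
apply: (@li3_free_gen _ _ a1 a2 a3) => k l m /lfunP h.
by split; [have := h e1|have := h e2|have := h e3];
  rewrite hE lfunE /= ?h11 ?h12 ?h13 ?h21 ?h22 ?h23 ?h31 ?h32 ?h33 => <-; ring.
Qed.

End Dim3.

End Bases.

(** * Products found in a pencil of binary forms *)

Section Products.
Variables (R : realType) (V : vectType R).
Hypothesis dimV : \dim {:V} = 3%N.
Variables (S : V -> V -> V -> V -> R) (ext : extremal (@C_W R V) S).
Implicit Types (a b : 'Hom(V, R^o)) (x y z p u v : V).
Local Notation G := (symp S).
Local Notation K := (altp S).

Let CS : C_W S. Proof. by case: ext. Qed.
Let WS : Wsym S. Proof. by case: ((C_WP S).1 CS). Qed.

Lemma dom_vee_wedge_type a b : a != 0 -> b != 0 ->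
  dominated S (fun x y => a x * b y + b x * a y) ->
  dominated S (fun x y => a x * b y - b x * a y) -> type12 S.
Proof.
move=> a0 b0 d1 d2; apply: (dom_product_type ext a0 b0).
by apply: dom_eq (dom_comb 2^-1 2^-1 d1 d2) => x y; field.
Qed.

Lemma symp_ge0 x y : 0 <= G x y x y.
Proof. by have [_ _ h] := symp_psd CS; have := h [:: (x, y)]; rewrite ev_seq1. Qed.
Lemma altp_ge0 x y : 0 <= K x y x y.
Proof. by have [_ _ h] := altp_psd CS; have := h [:: (x, y)]; rewrite ev_seq1. Qed.

Lemma symp_bilin x y : bilin (G x y).
Proof. exact: (symp_mult4 WS).2. Qed.
Lemma altp_bilin x y : bilin (K x y).
Proof. exact: (altp_mult4 WS).2. Qed.
Lemma symp_bilinl x y : bilin (fun u v => G u v x y).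
Proof. exact: (symp_mult4 WS).1. Qed.
Lemma altp_bilinl x y : bilin (fun u v => K u v x y).
Proof. exact: (altp_mult4 WS).1. Qed.

(* The forms [G u u] and [G u v] live on the plane V / p, and the trace of [det]
   on the pencil they span is controlled by [K u v u v >= 0]: either one of them is
   an indefinite product, whose wedge is a multiple of [K u v], or [K u v] vanishes
   and the pencil contains a form of rank one. *)
Lemma product_of_pencil_orth p u v : li3 p u v ->
  0 < G u u u u -> G u u u v = 0 ->
  (forall x, G u u p x = 0) -> (forall x, G u v p x = 0) -> (forall x, K u v p x = 0) ->
  type12 S.
Proof.
move=> li Apos B0 fp gp kp; have [a1 [a2 [a3 D]]] := li3_dual dimV li.
have fE x y : G u u x y = G u u u u * (a2 x * a2 y) + G u u v v * (a3 x * a3 y).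
  rewrite (sym_expand D x y (symp_bilin _ _)) ?fp ?B0; first by ring.
  by move=> *; rewrite (sympC WS).
have gE x y : G u v x y = G u v u v * (a2 x * a3 y + a3 x * a2 y) + G u v v v * (a3 x * a3 y).
  rewrite (sym_expand D x y (symp_bilin _ _)) ?gp.
    by rewrite (symp_sym4 WS u u u v) B0; ring.
  by move=> *; rewrite (sympC WS).
have kE x y : K u v x y = (G u v u v - G u u v v) * (a2 x * a3 y - a3 x * a2 y).
  rewrite (alt_expand D x y (altp_bilin _ _)) ?kp.
    by rewrite (altp_symp WS u u v v) (sympC WS u v u v); ring.
  by move=> *; rewrite (altpC WS).
have K0 : 0 <= G u v u v - G u u v v.
  by have := altp_ge0 u v; rewrite (altp_symp WS u u v v) (sympC WS u v u v).
have D0 := symp_ge0 u v.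
move: Apos fE gE kE K0 D0; set A := G u u u u; set C := G u u v v.
set E := G u v v v; set d := G u v u v => Apos fE gE kE K0 D0.
have df := dom_symp CS u u; have dg := dom_symp CS u v; have dk := dom_altp CS u v.
have [_ [a1p a1u a1v] [a2p a2u a2v] [a3p a3u a3v]] := D.
have neq0 (a : 'Hom(V, R^o)) x : a x != 0 :> R -> a != 0.
  by apply: contra => /eqP->; rewrite lfunE.
have hE (k l : R) a b x : (k *: a + l *: b) x = k * a x + l * b x :> R.
  by rewrite add_lfunE !scale_lfunE.
(* [G u u] is A a2^2 + C a3^2, so for C <= 0 it splits over the reals into r a2 - q a3 and r a2 + q
   a3. *)
have [C0|C0] := lerP C 0.
  pose r := Num.sqrt A; pose q := Num.sqrt (- C).
  have rr : r ^+ 2 = A by rewrite sqr_sqrtr // ltW.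
  have qq : q ^+ 2 = - C by rewrite sqr_sqrtr // oppr_ge0.
  have r0 : r != 0 by rewrite gt_eqF // sqrtr_gt0.
  apply: (@dom_vee_wedge_type (r *: a2 + (- q) *: a3) (r *: a2 + q *: a3)).
  - by apply: (neq0 _ u); rewrite hE a2u a3u mulr1 mulr0 addr0.
  - by apply: (neq0 _ u); rewrite hE a2u a3u mulr1 mulr0 addr0.
  - apply: dom_eq (domZ 2 df) => x y; rewrite fE !hE -rr.
    have -> : C = - q ^+ 2 by rewrite qq opprK.
    by ring.
  (* If d = C the quotient is 0 by convention, as it should be: d >= 0 >= C then forces q = 0. *)
  apply: dom_eq (domZ (2 * r * q / (d - C)) dk) => x y; rewrite kE !hE.
  have [dC|dC] := eqVneq (d - C) 0; last by field.
  have q0 : q = 0 by apply/eqP; rewrite -sqrf_eq0 qq; apply/eqP; lra.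
  by rewrite q0; ring.
(* Here [G u v] is the product of a3 and 2 d a2 + E a3 (up to the factor 1/2), and [K u v] is a
   nonzero multiple of their wedge. *)
have [dC|dC] := eqVneq d C; last first.
  have dp : d != 0 by rewrite gt_eqF //; lra.
  apply: (@dom_vee_wedge_type a3 ((2 * d) *: a2 + E *: a3)).
  - by apply: (neq0 _ v); rewrite a3v oner_eq0.
  - apply: (neq0 _ u); rewrite hE a2u a3u mulr1 mulr0 addr0.
    by rewrite mulf_neq0 // pnatr_eq0.
  - by apply: dom_eq (domZ 2 dg) => x y; rewrite gE !hE; ring.
  have dC' : d - C != 0 by rewrite subr_eq0.
  by apply: dom_eq (domZ (- (2 * d) / (d - C)) dk) => x y; rewrite kE !hE; field.
(* The form G u u + m G u v has rank one when m^2 d^2 = A (C + m E); [disc] is the square root of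
   the discriminant of this quadratic equation in m. *)
pose disc := Num.sqrt (A ^+ 2 * E ^+ 2 + 4 * A * C * d ^+ 2).
have dd : disc ^+ 2 = A ^+ 2 * E ^+ 2 + 4 * A * C * d ^+ 2.
  have h1 := sqr_ge0 (A * E); have h2 : 0 <= A * C * d ^+ 2.
    by rewrite mulr_ge0 ?sqr_ge0 // mulr_ge0 // ltW.
  by rewrite sqr_sqrtr //; lra.
have dn0 : d != 0 by rewrite dC gt_eqF.
have An0 : A != 0 by rewrite gt_eqF.
pose m := (A * E + disc) / (2 * d ^+ 2).
have mE : m ^+ 2 * d ^+ 2 = A * (C + m * E).
  have -> : m ^+ 2 * d ^+ 2 = (A ^+ 2 * E ^+ 2 + 2 * A * E * disc + disc ^+ 2) / (4 * d ^+ 2).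
    by rewrite /m; field.
  by rewrite dd /m; field.
pose a := 1 *: a2 + (m * d / A) *: a3.
have a0 : a != 0.
  by apply: (neq0 _ u); rewrite hE a2u a3u mulr1 mulr0 addr0 oner_eq0.
apply: (dom_product_type ext a0 a0).
apply: dom_eq (domZ A^-1 (dom_comb 1 m df dg)) => x y; rewrite fE gE !hE.
have -> : C = m ^+ 2 * d ^+ 2 / A - m * E by rewrite mE; field.
by field.
Qed.

(** Adding a multiple of u to v reduces to the orthogonal case: it keeps [K u v], and changes
    [G u v] only by a multiple of [G u u]. *)
Lemma product_of_pencil p u v : li3 p u v -> 0 < G u u u u ->
  (forall x, G u u p x = 0) -> (forall x, G u v p x = 0) -> (forall x, K u v p x = 0) ->
  type12 S.
Proof.
move=> li Apos fp gp kp; pose t := - (G u u u v / G u u u u).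
have bl := symp_bilinl; have br := symp_bilin.
have kuu x y : K u u x y = 0 by have := altpCl S u u x y; lra.
apply: (@product_of_pencil_orth p u (v + 0 *: p + t *: u)) => //.
- exact: li3_add.
- rewrite scale0r addr0 (bilinDr (br _ _)) (bilinZr (br _ _)) /t; field; exact: lt0r_neq0.
- by move=> x; rewrite scale0r addr0 (bilinDr (bl _ _)) (bilinZr (bl _ _)) gp fp; ring.
- move=> x; rewrite scale0r addr0 (bilinDr (altp_bilinl _ _)) (bilinZr (altp_bilinl _ _)).
  by rewrite kp kuu; ring.
Qed.

End Products.

Lemma tall_matrix_ker (F : fieldType) m n (M : 'M[F]_(m, n)) : (n < m)%N ->
  exists2 u : 'rV_m, u != 0 & u *m M = 0.
Proof.
move=> nm; have : kermx M != 0.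
  rewrite -mxrank_eq0 mxrank_ker subn_eq0 -ltnNge.
  exact: leq_ltn_trans (rank_leq_col M) nm.
by move=> /rowV0Pn[u /sub_kermxP uM u0]; exists u.
Qed.

(** * Gram decompositions and the dimension count *)

Section Counting.
Variables (R : realType) (V : vectType R).
Hypothesis dimV : \dim {:V} = 3%N.
Implicit Types (f g : V -> V -> R) (S X : V -> V -> V -> V -> R).

Lemma exists_detects : exists L : seq (V * V), detects L.
Proof.
have [e1 [e2 [e3 li]]] := exists_li3 dimV; have [a1 [a2 [a3 D]]] := li3_dual dimV li.
exists [seq (x, y) | x <- [:: e1; e2; e3], y <- [:: e1; e2; e3]] => f bf h x y.
have z u v : u \in [:: e1; e2; e3] -> v \in [:: e1; e2; e3] -> f u v = 0.
  by move=> uE vE; apply: (h (u, v)); apply: allpairs_f.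
by rewrite (bilin_expand D x y bf) !z ?inE ?eqxx ?orbT //; ring.
Qed.

Lemma symp_gram S : C_W S -> exists r (q : 'I_r -> V -> V -> R),
  [/\ forall k, bilin (q k), forall k x y, q k y x = q k x y, indep q &
      forall x y z w, symp S x y z w = \sum_k q k x y * q k z w].
Proof.
move=> CS; have [L dL] := exists_detects.
have WS : Wsym S by case: ((C_WP S).1 CS).
have [|r [q [h1 h2 h3 h4]]] := @gram_decomposition _ _ L 1 _ dL (symp_psd CS).
  by move=> *; rewrite mul1r (sympC WS).
by exists r, q; split=> // k x y; rewrite h2 mul1r.
Qed.

Lemma altp_gram S : C_W S -> exists r (q : 'I_r -> V -> V -> R),
  [/\ forall k, bilin (q k), forall k x y, q k y x = - q k x y, indep q &
      forall x y z w, altp S x y z w = \sum_k q k x y * q k z w].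
Proof.
move=> CS; have [L dL] := exists_detects.
have WS : Wsym S by case: ((C_WP S).1 CS).
have [|r [q [h1 h2 h3 h4]]] := @gram_decomposition _ _ L (-1) _ dL (altp_psd CS).
  by move=> *; rewrite mulN1r (altpC WS).
by exists r, q; split=> // k x y; rewrite h2 mulN1r.
Qed.

(* Seven candidates for a perturbation of [S] suffice, because invariance
   under [tau] amounts to six linear conditions when [dim V = 3]. *)
Lemma no_independent_perturbations S (X : 'I_7 -> V -> V -> V -> V -> R) :
  extremal (@C_W R V) S -> (forall i, mult4 (X i)) -> (forall i, sym4 (X i)) ->
  (forall i x y z w, X i y x w z = X i x y z w) ->
  (forall i, exists C, forall s, `|ev (X i) s s| <= C * ev S s s) ->
  (forall (u : 'I_7 -> R) (t : R), (forall x y z w, \sum_i u i * X i x y z w = t * S x y z w) ->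
    forall i, u i = 0) -> False.
Proof.
move=> ext mX sX pX bX iX.
have [e1 [e2 [e3 li]]] := exists_li3 dimV; have [a1 [a2 [a3 D]]] := li3_dual dimV li.
(* The defect N(x,y,z,w) - N(x,w,z,y) is alternating in x, z and in y, w, and symmetric under
   exchange of these two pairs. As a symmetric form on the three-dimensional Lambda^2 V it has these
   six entries. *)
pose c : seq (V * V * V * V) :=
  [:: (e1, e1, e2, e2); (e1, e1, e2, e3); (e1, e2, e2, e3);
      (e1, e1, e3, e3); (e1, e2, e3, e3); (e2, e2, e3, e3)].
pose dX i (p : V * V * V * V) := X i p.1.1.1 p.1.1.2 p.1.2 p.2 - X i p.1.1.1 p.2 p.1.2 p.1.1.2.
pose M : 'M[R]_(7, 6) := \matrix_(i, j) dX i (nth (0, 0, 0, 0) c j).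
have [//|u u0 uM] := tall_matrix_ker M.
pose N x y z w : R := \sum_i u 0 i * X i x y z w.
have NE x y z w : N x y z w = \sum_i u 0 i * X i x y z w by [].
have mN : mult4 N.
  apply: (mult4_sum (F := fun i x y z w => u 0 i * X i x y z w)) => i.
  by split=> x y; [exact: bilinZ ((mX i).1 x y)|exact: bilinZ ((mX i).2 x y)].
have sN : sym4 N by move=> x y z w; apply: eq_bigr => i _; rewrite sX.
have pN x y z w : N y x w z = N x y z w by apply: eq_bigr => i _; rewrite pX.
pose d x y z w := N x y z w - N x w z y.
have d13 x y z w : d z y x w = - d x y z w by rewrite /d (sN x w) (sN x y); ring.
have d24 x y z w : d x w z y = - d x y z w by rewrite /d; ring.
have dp x y z w : d y x w z = d x y z w by rewrite /d pN (pN z y x w) (sN x w).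
have b13 y w : bilin (fun x z => d x y z w).
  have [m1 m2] := mN; split=> k x x' z; rewrite /d.
    by rewrite !(m1 _ _).1; ring.
  by rewrite !(m2 _ _).1; ring.
have b24 x z : bilin (fun y w => d x y z w).
  have [m1 m2] := mN; split=> k y y' w; rewrite /d.
    by rewrite (m1 _ _).2 (m2 _ _).2; ring.
  by rewrite (m1 _ _).2 (m2 _ _).2; ring.
have dc p : p \in c -> d p.1.1.1 p.1.1.2 p.1.2 p.2 = 0.
  move=> pc; have jlt : (index p c < 6)%N by rewrite index_mem.
  have := congr1 (fun A : 'rV[R]_6 => A 0 (Ordinal jlt)) uM; rewrite !mxE => h.
  rewrite /d /N -sumrB -[RHS]h; apply: eq_bigr => i _.
  by rewrite mxE /dX /= nth_index // mulrBr.
have hc k l m n : (k, l, m, n) \in c -> d k l m n = 0 by move=> /dc.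
have d0 x y z w : d x y z w = 0.
  rewrite (alt_expand D x z (b13 y w)); last by move=> *; rewrite d13.
  rewrite !(alt_expand D y w (b24 _ _)); try by move=> *; rewrite d24.
  rewrite (dp e1 e1 e2 e3) (dp e1 e2 e2 e3) (dp e1 e2 e3 e3).
  by rewrite !hc ?inE ?eqxx ?orbT //; ring.
have WN : Wsym N.
  split=> // x y z w; rewrite sN; have := d0 x y z w; rewrite /d; lra.
have {bX} [C hC] : exists C, forall s, `|ev N s s| <= C * ev S s s.
  have [C hC] := choice bX; exists (\sum_i `|u 0 i| * C i) => s.
  have -> : ev N s s = \sum_i u 0 i * ev (X i) s s.
    rewrite (ev_sum (fun i x y z w => u 0 i * X i x y z w)); apply: eq_bigr => i _.
    by rewrite mulr_sumr; apply: eq_bigr => p _; rewrite ev2_mull.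
  apply: le_trans (ler_norm_sum _ _ _) _; rewrite mulr_suml; apply: ler_sum => i _.
  by rewrite normrM -mulrA ler_wpM2l.
have [t ht] := extremal_perturb ext WN hC.
have z := iX (u 0) t ht.
by move/eqP: u0; apply; apply/rowP => i; rewrite z mxE.
Qed.

(* The entries of the symmetrised elementary matrix [E_ij], or of 0 for [None]. *)
Definition sdelta (o : option (nat * nat)) (k l : nat) : R :=
  if o is Some (i, j) then (((k == i) && (l == j)) || ((k == j) && (l == i)))%:R else 0.

Lemma sdeltaC o k l : sdelta o k l = sdelta o l k.
Proof. by case: o => // [[i j]] /=; rewrite orbC ![(l == _) && _]andbC. Qed.

Lemma indep2 r (q : 'I_r -> V -> V -> R) (H : 'I_r -> 'I_r -> R) : indep q ->
  (forall x y z w, \sum_k \sum_l H k l * (q k x y * q l z w) = 0) -> forall k l, H k l = 0.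
Proof.
move=> iq h k; apply: (iq) => z w.
apply: (iq (fun k => \sum_l H k l * q l z w)) => x y.
rewrite -[RHS](h x y z w); apply: eq_bigr => i _; rewrite mulr_suml.
by apply: eq_bigr => j _; ring.
Qed.

(** The i-th perturbation has the symmetric matrix [P i] in the q_k and [Q i] in the w_k. A
    combination equal to t S has matrices t times the identity; since no [P i] has an entry at (0,
    0), t = 0, and it remains only that the seven pairs of matrices be independent. *)
Lemma rank_bound S r (q : 'I_r -> V -> V -> R) s (w : 'I_s -> V -> V -> R)
  (P Q : 'I_7 -> option (nat * nat)) :
  extremal (@C_W R V) S -> (forall k, bilin (q k)) -> (forall k, bilin (w k)) ->
  (forall k x y, q k y x = q k x y) -> (forall k x y, w k y x = - w k x y) ->
  indep q -> indep w ->
  (forall x y z t, symp S x y z t = \sum_k q k x y * q k z t) ->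
  (forall x y z t, altp S x y z t = \sum_k w k x y * w k z t) ->
  (0 < r)%N -> (forall i, sdelta (P i) 0 0 = 0) ->
  (forall u : 'I_7 -> R, (forall k l, (k < r)%N -> (l < r)%N -> \sum_i u i * sdelta (P i) k l = 0) ->
     (forall k l, (k < s)%N -> (l < s)%N -> \sum_i u i * sdelta (Q i) k l = 0) ->
     forall i, u i = 0) -> False.
Proof.
move=> ext bq bw sq aw iq iw Gq Kw r0 P0 PQ.
have CS : C_W S by case: ext.
have WS : Wsym S by case: ((C_WP S).1 CS).
pose Y n (T : 'I_n -> V -> V -> R) (H : nat -> nat -> R) x y z t : R :=
  \sum_(k < n) \sum_(l < n) H k l * (T k x y * T l z t).
have mY n (T : 'I_n -> V -> V -> R) (H : nat -> nat -> R) :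
    (forall k, bilin (T k)) -> mult4 (Y n T H).
  move=> bT; apply: (mult4_sum (F := fun k x y z t => \sum_(l < n) H k l * (T k x y * T l z t))).
  move=> k; apply: (mult4_sum (F := fun l x y z t => H k l * (T k x y * T l z t))) => l.
  have [m1 m2] := mult4_prod (bT k) (bT l).
  by split=> x y; [exact: bilinZ (m1 x y)|exact: bilinZ (m2 x y)].
have sY n (T : 'I_n -> V -> V -> R) H : (forall k l, H k l = H l k) -> sym4 (Y n T H).
  move=> sH x y z t; rewrite /Y exchange_big; apply: eq_bigr => k _; apply: eq_bigr => l _.
  by rewrite sH [T l _ _ * _]mulrC.
have evY n (T : 'I_n -> V -> V -> R) (H : nat -> nat -> R) p :
    ev (Y n T H) p p = \sum_(k < n) \sum_(l < n) H k l * (ev2 (T k) p * ev2 (T l) p).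
  rewrite (ev_sum (fun k x y z t => \sum_(l < n) H k l * (T k x y * T l z t))).
  apply: eq_bigr => k _; rewrite (ev_sum (fun l x y z t => H k l * (T k x y * T l z t))).
  apply: eq_bigr => l _; rewrite -ev_prod {2}/ev mulr_sumr.
  by apply: eq_bigr => i _; rewrite ev2_mull.
(* Each of the n^2 terms is at most [ev S p p], by 2 |a b| <= a^2 + b^2. *)
have bndY n (T : 'I_n -> V -> V -> R) H p : (forall k l, `|H k l| <= 1) ->
    (\sum_k ev2 (T k) p ^+ 2 <= ev S p p) -> `|ev (Y n T H) p p| <= (n * n)%:R * ev S p p.
  move=> H1 le; rewrite evY; apply: le_trans (ler_norm_sum _ _ _) _.
  apply: (@le_trans _ _ (\sum_(k < n) \sum_(l < n) ev S p p)); last first.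
    by rewrite !sumr_const !card_ord -mulrnA mulr_natl.
  apply: ler_sum => k _; apply: le_trans (ler_norm_sum _ _ _) _; apply: ler_sum => l _.
  have le1 i : ev2 (T i) p ^+ 2 <= ev S p p.
    apply: le_trans le; rewrite (bigD1 i) //= lerDl sumr_ge0 // => j _; exact: sqr_ge0.
  rewrite normrM; apply: (@le_trans _ _ (1 * `|ev2 (T k) p * ev2 (T l) p|)).
    by rewrite ler_wpM2r.
  rewrite mul1r normrM; have := le1 k; have := le1 l.
  rewrite -(real_normK (num_real (ev2 (T k) p))) -(real_normK (num_real (ev2 (T l) p))).
  by have := sqr_ge0 (`|ev2 (T k) p| - `|ev2 (T l) p|); lra.
have evS p : ev S p p = \sum_k ev2 (q k) p ^+ 2 + \sum_k ev2 (w k) p ^+ 2.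
  have -> : S = fun x y z t => 1 * (\sum_k q k x y * q k z t) + 1 * (\sum_k w k x y * w k z t).
    by apply: tensor4P => x y z t; rewrite !mul1r -Gq -Kw -(symp_altp S).
  rewrite (ev_comb (fun x y z t => \sum_k q k x y * q k z t)
    (fun x y z t => \sum_k w k x y * w k z t)) !ev_gram !mul1r.
  by congr (_ + _); apply: eq_bigr.
have le_q p : \sum_k ev2 (q k) p ^+ 2 <= ev S p p.
  by rewrite evS lerDl sumr_ge0 // => k _; exact: sqr_ge0.
have le_w p : \sum_k ev2 (w k) p ^+ 2 <= ev S p p.
  by rewrite evS lerDr sumr_ge0 // => k _; exact: sqr_ge0.
have D1 o k l : `|sdelta o k l| <= 1.
  by case: o => [[i j]|] /=; rewrite ?normr0 // normr_nat lern1 leq_b1.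
pose X i x y z t : R := 1 * Y r q (sdelta (P i)) x y z t + 1 * Y s w (sdelta (Q i)) x y z t.
apply: (@no_independent_perturbations S X ext).
- by move=> i; apply: mult4D; exact: mY.
- move=> i x y z t; rewrite /X (sY r q (sdelta (P i)) (@sdeltaC _) x y z t).
  by rewrite (sY s w (sdelta (Q i)) (@sdeltaC _) x y z t).
- move=> i x y z t; rewrite /X; congr (1 * _ + 1 * _).
    by apply: eq_bigr => k _; apply: eq_bigr => l _; rewrite (sq _ x) (sq _ z).
  by apply: eq_bigr => k _; apply: eq_bigr => l _; rewrite (aw _ x) (aw _ z); ring.
- move=> i; exists ((r * r)%:R + (s * s)%:R) => p.
  rewrite (ev_comb (Y r q (sdelta (P i))) (Y s w (sdelta (Q i)))) !mul1r.
  by apply: le_trans (ler_normD _ _) _; rewrite mulrDl lerD // bndY.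
move=> u t h; have {}h x y z v : Y r q (fun k l => \sum_i u i * sdelta (P i) k l) x y z v +
    Y s w (fun k l => \sum_i u i * sdelta (Q i) k l) x y z v = t * S x y z v.
  rewrite -h; have E n (T : 'I_n -> V -> V -> R) (O : 'I_7 -> option (nat * nat)) :
     Y n T (fun k l => \sum_i u i * sdelta (O i) k l) x y z v =
     \sum_i u i * Y n T (sdelta (O i)) x y z v.
    rewrite /Y; under [RHS]eq_bigr do rewrite mulr_sumr.
    rewrite [RHS]exchange_big; apply: eq_bigr => k _.
    under [RHS]eq_bigr do rewrite mulr_sumr.
    rewrite [RHS]exchange_big; apply: eq_bigr => l _.
    by rewrite mulr_suml; apply: eq_bigr => i _; rewrite -mulrA.
  by rewrite !E -big_split; apply: eq_bigr => i _ /=; rewrite /X; ring.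
(* Averaging over the swap of the first two arguments separates the matrix in the q_k from the one
   in the w_k. *)
have hq x y z v : Y r q (fun k l => \sum_i u i * sdelta (P i) k l) x y z v = t * symp S x y z v.
  have := h x y z v; have := h y x z v; rewrite /symp.
  have -> : Y r q (fun k l => \sum_i u i * sdelta (P i) k l) y x z v =
            Y r q (fun k l => \sum_i u i * sdelta (P i) k l) x y z v.
    by apply: eq_bigr => k _; apply: eq_bigr => l _; rewrite (sq _ x).
  have -> : Y s w (fun k l => \sum_i u i * sdelta (Q i) k l) y x z v =
            - Y s w (fun k l => \sum_i u i * sdelta (Q i) k l) x y z v.
    rewrite -sumrN; apply: eq_bigr => k _; rewrite -sumrN; apply: eq_bigr => l _.
    by rewrite (aw _ x); ring.
  by move=> h1 h2; lra.
have hw x y z v : Y s w (fun k l => \sum_i u i * sdelta (Q i) k l) x y z v = t * altp S x y z v.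
  have := h x y z v; rewrite hq (symp_altp S x y z v) => E.
  by apply: (@addrI _ (t * symp S x y z v)); rewrite E mulrDr.
have main n (T : 'I_n -> V -> V -> R) (H : nat -> nat -> R) (X' : V -> V -> V -> V -> R) : indep T ->
    (forall x y z v, X' x y z v = \sum_k T k x y * T k z v) ->
    (forall x y z v, Y n T H x y z v = t * X' x y z v) ->
    forall k l : 'I_n, H k l = t * (k == l)%:R.
  move=> iT XT YT k l; apply/eqP; rewrite -subr_eq0; apply/eqP.
  apply: (indep2 (H := fun k l : 'I_n => H k l - t * (k == l)%:R) iT) => x y z v.
  have := YT x y z v; rewrite XT mulr_sumr => /eqP; rewrite -subr_eq0 => /eqP h0.
  rewrite -[RHS]h0 /Y -sumrB; apply: eq_bigr => i _.
  under eq_bigr do rewrite mulrBl.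
  rewrite sumrB; congr (_ - _); rewrite (bigD1 i) //= big1 ?addr0 ?eqxx ?mulr1 //.
  by move=> j ji; rewrite eq_sym (negbTE ji) mulr0 mul0r.
have mq := main _ _ _ _ iq Gq hq; have mw := main _ _ _ _ iw Kw hw.
have t0 : t = 0.
  have := mq (Ordinal r0) (Ordinal r0); rewrite eqxx mulr1 => <-.
  by rewrite big1 // => i _; rewrite P0 mulr0.
apply: PQ => k l kr lr.
  by have := mq (Ordinal kr) (Ordinal lr); rewrite t0 mul0r.
by have := mw (Ordinal kr) (Ordinal lr); rewrite t0 mul0r.
Qed.

End Counting.

Lemma forall_ord7 (P : 'I_7 -> Prop) :
  P (@Ordinal 7 0 isT) -> P (@Ordinal 7 1 isT) -> P (@Ordinal 7 2 isT) -> P (@Ordinal 7 3 isT) ->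
  P (@Ordinal 7 4 isT) -> P (@Ordinal 7 5 isT) -> P (@Ordinal 7 6 isT) -> forall i, P i.
Proof.
move=> h0 h1 h2 h3 h4 h5 h6 [[|[|[|[|[|[|[|//]]]]]]] lt];
  [move: h0|move: h1|move: h2|move: h3|move: h4|move: h5|move: h6];
  by congr P; apply: val_inj.
Qed.

Lemma sum_ord7 (R : nmodType) (F : 'I_7 -> R) : \sum_(i < 7) F i =
  F (@Ordinal 7 0 isT) + F (@Ordinal 7 1 isT) + F (@Ordinal 7 2 isT) + F (@Ordinal 7 3 isT) +
  F (@Ordinal 7 4 isT) + F (@Ordinal 7 5 isT) + F (@Ordinal 7 6 isT).
Proof.
rewrite !big_ord_recr big_ord0 /= add0r.
by congr (F _ + F _ + F _ + F _ + F _ + F _ + F _); apply: val_inj.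
Qed.

(** * Bounds on the ranks, and the cases settled by a kernel vector *)

Section Ranks.
Variables (R : realType) (V : vectType R).
Hypothesis dimV : \dim {:V} = 3%N.
Variables (S : V -> V -> V -> V -> R) (ext : extremal (@C_W R V) S).
Implicit Types (a b : 'Hom(V, R^o)) (x y z p u v e : V).
Local Notation G := (symp S).
Local Notation K := (altp S).

Let CS : C_W S. Proof. by case: ext. Qed.
Let WS : Wsym S. Proof. by case: ((C_WP S).1 CS). Qed.

(** Seven elementary symmetric matrices avoiding the entry (0, 0) of the q-block are available as
    soon as r >= 4 (seven of nine), or r >= 3 and s >= 2 (taken as 4 + 3), or r >= 2 and s >= 3
    (taken as 1 + 6). *)
Lemma extremal_rank_bounds r (q : 'I_r -> V -> V -> R) s (w : 'I_s -> V -> V -> R) :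
  (forall k, bilin (q k)) -> (forall k, bilin (w k)) ->
  (forall k x y, q k y x = q k x y) -> (forall k x y, w k y x = - w k x y) ->
  indep q -> indep w ->
  (forall x y z t, G x y z t = \sum_k q k x y * q k z t) ->
  (forall x y z t, K x y z t = \sum_k w k x y * w k z t) ->
  [/\ (r <= 3)%N, (2 < r -> s <= 1)%N & (1 < r -> s <= 2)%N].
Proof.
move=> bq bw sq aw iq iw Gq Kw.
have H (P Q : seq (option (nat * nat))) := @rank_bound R V dimV S r q s w
  (fun i => nth None P i) (fun i => nth None Q i) ext bq bw sq aw iq iw Gq Kw.
split.
- rewrite leqNgt; apply/negP => r4.
  apply: (H [:: Some (0, 1); Some (0, 2); Some (0, 3); Some (1, 1);
                Some (1, 2); Some (1, 3); Some (2, 2)]%N [::]).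
  + exact: leq_trans r4.
  + exact: forall_ord7.
  move=> u hP _.
  have h k l : (k < 4)%N -> (l < 4)%N -> _ := fun k4 l4 =>
    hP k l (leq_trans k4 r4) (leq_trans l4 r4).
  apply: forall_ord7; [have := h 0%N 1%N isT isT|have := h 0%N 2%N isT isT
    |have := h 0%N 3%N isT isT|have := h 1%N 1%N isT isT|have := h 1%N 2%N isT isT
    |have := h 1%N 3%N isT isT|have := h 2%N 2%N isT isT];
    by rewrite sum_ord7 /= !mulr0 mulr1 ?add0r ?addr0.
- move=> r3; rewrite leqNgt; apply/negP => s2.
  apply: (H [:: Some (0, 1); Some (0, 2); Some (1, 1); Some (1, 2)]%N
    [:: None; None; None; None; Some (0, 0); Some (0, 1); Some (1, 1)]%N).
  + exact: leq_trans r3.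
  + exact: forall_ord7.
  move=> u hP hQ.
  have h k l : (k < 3)%N -> (l < 3)%N -> _ := fun k4 l4 =>
    hP k l (leq_trans k4 r3) (leq_trans l4 r3).
  have h' k l : (k < 2)%N -> (l < 2)%N -> _ := fun k4 l4 =>
    hQ k l (leq_trans k4 s2) (leq_trans l4 s2).
  apply: forall_ord7; [have := h 0%N 1%N isT isT|have := h 0%N 2%N isT isT
    |have := h 1%N 1%N isT isT|have := h 1%N 2%N isT isT|have := h' 0%N 0%N isT isT
    |have := h' 0%N 1%N isT isT|have := h' 1%N 1%N isT isT];
    by rewrite sum_ord7 /= !mulr0 mulr1 ?add0r ?addr0.
- move=> r2; rewrite leqNgt; apply/negP => s3.
  apply: (H [:: Some (0, 1)]%N
    [:: None; Some (0, 0); Some (0, 1); Some (0, 2); Some (1, 1); Some (1, 2); Some (2, 2)]%N).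
  + exact: leq_trans r2.
  + exact: forall_ord7.
  move=> u hP hQ.
  have h' k l : (k < 3)%N -> (l < 3)%N -> _ := fun k4 l4 =>
    hQ k l (leq_trans k4 s3) (leq_trans l4 s3).
  apply: forall_ord7; [have := hP 0%N 1%N (leq_trans _ r2) (leq_trans _ r2) => /(_ isT isT)
    |have := h' 0%N 0%N isT isT|have := h' 0%N 1%N isT isT|have := h' 0%N 2%N isT isT
    |have := h' 1%N 1%N isT isT|have := h' 1%N 2%N isT isT|have := h' 2%N 2%N isT isT];
    by rewrite sum_ord7 /= !mulr0 mulr1 ?add0r ?addr0.
Qed.

Lemma symp_ker x y z w : G x y x y = 0 -> G x y z w = 0.
Proof. by have := @psd_ker _ _ _ [:: (x, y)] [:: (z, w)] (symp_psd CS); rewrite !ev_seq1. Qed.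

Lemma altp_of_symp_eq0 : (forall x y z w, G x y z w = 0) -> False.
Proof.
move=> G0; have [_ nz _] := ext; move/eqP: nz; apply; apply: tensor4P => x y z w.
by rewrite (symp_altp S) (altp_symp WS x z y w) !G0 subrr addr0.
Qed.

Lemma exists_symp_gt0 : exists u, 0 < G u u u u.
Proof.
apply: contrapT => h; apply: altp_of_symp_eq0 => x y z w.
have G0 u z' w' : G u u z' w' = 0.
  apply: symp_ker; apply/eqP; rewrite eq_le symp_ge0 // andbT leNgt.
  by apply/negP => p; apply: h; exists u.
have bl := symp_bilinl ext.
have := G0 (x + y) z w; rewrite !(bilinDl (bl _ _)) !(bilinDr (bl _ _)) !G0 (sympCl S x y); lra.
Qed.

(** With the symmetry of G in its last two arguments, this makes G(e, . , . , . ) a cubic form. *)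
Lemma symp_eps e x y z : (forall x y z, K e x y z = 0) -> G e x y z = G e y x z.
Proof.
move=> Ke; have := altp_symp WS e y z x; rewrite Ke => /eqP.
by rewrite eq_sym subr_eq0 => /eqP; rewrite (sympC WS e x) => ->; rewrite (sympC WS).
Qed.

(** G(e,x,e,x) = G(e,e,x,x) = 0 for all x, so e is in the kernel of G and K, and any u with
    G(u,u,u,u) > 0 gives a pencil on V / e. *)
Lemma type12_of_kernel e : e != 0 -> (forall x y z, K e x y z = 0) -> G e e e e = 0 -> type12 S.
Proof.
move=> e0 Ke G0; have Gex x y z : G e x y z = 0.
  by apply: symp_ker; rewrite (symp_eps x e x Ke) symp_ker.
have [u u0] := exists_symp_gt0.
have l2 : li2 e u.
  move=> k l E; have l0 : l = 0.
    apply/eqP; apply: contraT => l0; move: u0.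
    have -> : u = (- (k / l)) *: e.
      apply: (scalerI l0); rewrite scalerA mulrN mulrCA mulfV // mulr1 scaleNr.
      by apply/eqP; rewrite -addr_eq0 addrC E.
    rewrite (bilinZl (symp_bilinl ext _ _)) (bilinZr (symp_bilinl ext _ _)).
    by rewrite Gex !mulr0 ltxx.
  by move: E; rewrite l0 scale0r addr0 => /eqP; rewrite scaler_eq0 (negbTE e0) orbF => /eqP.
have [v li] := extend_li2 dimV l2.
apply: (product_of_pencil dimV ext li u0) => x.
- by rewrite (symp_sym4 WS) Gex.
- by rewrite (symp_sym4 WS) Gex.
- by rewrite (altp_sym4 WS) Ke.
Qed.

(** The pencil is that of [G e e] and [G e z] on V / y: both forms kill y because G(e,y, . , . ) = 0
    and G(e, . , . , . ) is symmetric. *)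
Lemma type12_of_degenerate e y : e != 0 -> y != 0 -> (forall x y z, K e x y z = 0) ->
  G e y e y = 0 -> type12 S.
Proof.
move=> e0 y0 Ke G0.
have [Ge|Ge] := eqVneq (G e e e e) 0; first exact: (type12_of_kernel e0 Ke Ge).
have Gey x z : G e y x z = 0 by exact: symp_ker.
have l2 : li2 y e.
  move=> k l E; have k0 : k = 0.
    apply/eqP; apply: contraT => k0; move: Ge.
    have l0 : l != 0.
      apply: contraTneq k0 => l0; move: E.
      by rewrite l0 scale0r addr0 => /eqP; rewrite scaler_eq0 (negbTE y0) orbF negbK.
    have := Gey e e; have -> : y = (- (l / k)) *: e.
      apply: (scalerI k0); rewrite scalerA mulrN mulrCA mulfV // mulr1 scaleNr.
      by apply/eqP; rewrite -addr_eq0 E.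
    rewrite (bilinZr (symp_bilinl ext _ _)) => /eqP; rewrite mulf_eq0 oppr_eq0.
    by rewrite mulf_eq0 invr_eq0 (negbTE l0) (negbTE k0) /= => ->.
  by split=> //; move: E; rewrite k0 scale0r add0r => /eqP; rewrite scaler_eq0 (negbTE e0) orbF => /eqP.
have [z li] := extend_li2 dimV l2.
apply: (product_of_pencil dimV ext li) => [|x|x|x].
- by rewrite lt_def Ge symp_ge0.
- by rewrite symp_eps.
- by rewrite symp_eps.
- exact: Ke.
Qed.

(** K >= 0 says that every 2 by 2 principal minor of q is at most 0. A form of rank three cannot
    satisfy this, and a kernel vector of q is killed by both G and K. *)
Lemma type12_of_rank1 (q : V -> V -> R) : bilin q -> (forall x y, q y x = q x y) ->
  (forall x y z w, G x y z w = q x y * q z w) -> type12 S.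
Proof.
move=> bq sq Gq; have [v] := exists_symp_gt0; rewrite Gq => qv.
have qv0 : q v v != 0 by apply: contraTneq qv => ->; rewrite mulr0 ltxx.
have v0 : v != 0 by apply: contraNneq qv0 => ->; rewrite bilin0l.
have [y0 [z0 li0]] := extend_neq0 dimV v0.
pose c x := - (q v x / q v v).
pose y := y0 + c y0 *: v; pose z := z0 + c z0 *: v.
have li : li3 v y z.
  have h1 := @li3_add _ _ _ _ _ (c z0) 0 li0; rewrite scale0r addr0 in h1.
  have h2 := @li3_add _ _ _ _ _ (c y0) 0 (li3C23 h1); rewrite scale0r addr0 in h2.
  exact: li3C23.
have cE x : q v (x + c x *: v) = 0.
  by rewrite (bilinDr bq) (bilinZr bq) /c; field.
have qvy : q v y = 0 by exact: cE.
have qvz : q v z = 0 by exact: cE.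
clearbody y z => {cE}.
have Kxy x t : 0 <= q x t ^+ 2 - q x x * q t t.
  have := altp_ge0 ext x t; rewrite (altp_symp WS x x t t) !Gq (sq x t).
  by rewrite expr2.
(* The minors on v and t y + z make - q(v,v) q positive on the orthogonal plane of v, so its
   determinant there is nonnegative; the minor on y, z gives the opposite inequality. *)
have le : (q v v * q y z) ^+ 2 <= (q v v * q y y) * (q v v * q z z).
  rewrite -sqrrN -[X in _ <= X]mulrNN -mulrN.
  apply: quadratic_discr_le => t; have := Kxy v (t *: y + z).
  rewrite !(bilinDr bq) !(bilinDl bq) !(bilinZr bq) !(bilinZl bq) qvy qvz (sq y z).
  by move=> h; move: h; rewrite mulr0 addr0 expr0n /= sub0r; lra.
have det0 : q y z ^+ 2 = q y y * q z z.
  apply/le_anti/andP; split; last by rewrite -subr_ge0 Kxy.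
  move: le; have -> : (q v v * q y z) ^+ 2 = q v v ^+ 2 * q y z ^+ 2 by ring.
  have -> : q v v * q y y * (q v v * q z z) = q v v ^+ 2 * (q y y * q z z) by ring.
  by rewrite ler_pM2l // exprn_even_gt0.
have [a1 [a2 [a3 D]]] := li3_dual dimV li.
suff [e e0 qe] : exists2 e, e != 0 & forall x, q e x = 0.
  apply: (type12_of_kernel e0); last by rewrite Gq qe mul0r.
  by move=> x t w; rewrite (altp_symp WS e t x w) !Gq !qe !mul0r subrr.
have [qyy|qyy] := eqVneq (q y y) 0.
  have qyz : q y z = 0 by apply/eqP; rewrite -sqrf_eq0 det0 qyy mul0r.
  exists y; first exact: (li3_neq0 (li3C12 li)).
  have [E _ _ _] := D; move=> x; rewrite (E x) !(bilinDr bq) !(bilinZr bq).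
  by rewrite (sq v y) qvy qyy qyz; ring.
exists (z + 0 *: v + (- (q y z / q y y)) *: y).
  apply: (@li3_neq0 _ _ _ v y); apply: li3C12; apply: li3C23; exact: li3_add.
have [E _ _ _] := D; move=> x; rewrite (E x) scale0r addr0.
rewrite !(bilinDr bq) !(bilinZr bq) !(bilinDl bq) !(bilinZl bq).
rewrite (sq v z) (sq v y) qvy qvz (sq y z).
have -> : q z z = q y z ^+ 2 / q y y by rewrite det0; field.
by field.
Qed.

End Ranks.

(* Three vectors of the plane have a vanishing Gram determinant. *)
Lemma plane_orth_eq0 (R : realFieldType) (p1 p2 a1 a2 b1 b2 : R) :
  a1 ^+ 2 + a2 ^+ 2 != 0 -> b1 ^+ 2 + b2 ^+ 2 != 0 -> a1 * b1 + a2 * b2 = 0 ->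
  p1 * a1 + p2 * a2 = 0 -> p1 * b1 + p2 * b2 = 0 -> p1 = 0 /\ p2 = 0.
Proof.
move=> an bn ab pa pb; have : p1 ^+ 2 + p2 ^+ 2 = 0.
  apply: (mulIf an); apply: (mulIf bn); rewrite !mul0r.
  have -> : (p1 ^+ 2 + p2 ^+ 2) * (a1 ^+ 2 + a2 ^+ 2) * (b1 ^+ 2 + b2 ^+ 2) =
    (p1 ^+ 2 + p2 ^+ 2) * (a1 * b1 + a2 * b2) ^+ 2 +
    (p1 * a1 + p2 * a2) * ((p1 * a1 + p2 * a2) * (b1 ^+ 2 + b2 ^+ 2)
       - (a1 * b1 + a2 * b2) * (p1 * b1 + p2 * b2)) -
    (p1 * b1 + p2 * b2) * ((p1 * a1 + p2 * a2) * (a1 * b1 + a2 * b2)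
       - (a1 ^+ 2 + a2 ^+ 2) * (p1 * b1 + p2 * b2)) by ring.
  by rewrite ab pa pb; ring.
move=> /eqP; rewrite paddr_eq0 ?sqr_ge0 // !sqrf_eq0.
by case/andP=> /eqP-> /eqP->.
Qed.

(** * Kernels of 2-forms in dimension three *)

Section AltKernel.
Variables (R : realType) (V : vectType R).
Variables (e1 e2 e3 : V) (a1 a2 a3 : 'Hom(V, R^o)) (D : dual3 e1 e2 e3 a1 a2 a3).
Implicit Types (w : V -> V -> R).

(* The identification of Lambda^2 V^* with V given by the volume form. *)
Definition alt_kernel w := w e2 e3 *: e1 - w e1 e3 *: e2 + w e1 e2 *: e3.

Lemma alt_kernelP w x : bilin w -> (forall x y, w y x = - w x y) -> w (alt_kernel w) x = 0.
Proof.
move=> bw aw; have z u : w u u = 0 by have := aw u u; lra.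
have [E _ _ _] := D.
rewrite (E x) /alt_kernel !(bilinDr bw) !(bilinZr bw) !(bilinDl bw) !(bilinNl bw) !(bilinZl bw).
by rewrite !z (aw e1 e2) (aw e1 e3) (aw e2 e3); ring.
Qed.

Lemma alt_kernel_comb w w' (k l : R) :
  alt_kernel (fun x y => k * w x y + l * w' x y) = k *: alt_kernel w + l *: alt_kernel w'.
Proof.
rewrite /alt_kernel !scalerDl opprD !scalerDr !scalerN !scalerA.
by rewrite [X in X + _ = _]addrACA [LHS]addrACA.
Qed.

Lemma alt_kernel_eq0 w : bilin w -> (forall x y, w y x = - w x y) -> li3 e1 e2 e3 ->
  alt_kernel w = 0 -> forall x y, w x y = 0.
Proof.
move=> bw aw li; rewrite /alt_kernel -scaleNr => /li[h1 h2 h3] x y.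
have {}h2 : w e1 e3 = 0 by apply: oppr_inj; rewrite h2 oppr0.
by rewrite (alt_expand D x y bw) // h1 h2 h3; ring.
Qed.

End AltKernel.

(** * The case where G and K both have rank two *)

Section RankTwoTwo.
Variables (R : realType) (V : vectType R).
Hypothesis dimV : \dim {:V} = 3%N.
Variables (S : V -> V -> V -> V -> R) (ext : extremal (@C_W R V) S).
Implicit Types (a b : 'Hom(V, R^o)) (x y z p u v e : V) (f : V -> V -> R).
Local Notation G := (symp S).
Local Notation K := (altp S).

Let CS : C_W S. Proof. by case: ext. Qed.
Let WS : Wsym S. Proof. by case: ((C_WP S).1 CS). Qed.

(* [K] vanishes on the bivector [x /\ y], and its range consists of all the
   2-forms that do so. *)
Definition alt_plane x y z := [/\ li3 x y z, forall u v, K x y u v = 0 &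
  forall f, bilin f -> (forall u v, f v u = - f u v) -> f x y = 0 -> dominated S f].

(** A change of basis of the plane only multiplies x /\ y by its determinant. *)
Lemma alt_plane_change x y z (k l m n : R) : k * n - l * m != 0 ->
  alt_plane x y z -> alt_plane (k *: x + l *: y) (m *: x + n *: y) z.
Proof.
move=> det [li Kxy dm].
have E f : bilin f -> (forall u v, f v u = - f u v) ->
    f (k *: x + l *: y) (m *: x + n *: y) = (k * n - l * m) * f x y.
  move=> bf af; have zz u : f u u = 0 by have := af u u; lra.
  rewrite !(bilinDl bf) !(bilinDr bf) !(bilinZl bf) !(bilinZr bf) !zz (af x y); ring.
split.
- move=> p q r h; have [] := li (p * k + q * m) (p * l + q * n) r.
    rewrite -[RHS]h !scalerDr !scalerDl !scalerA; congr (_ + _).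
    by rewrite -!addrA; congr (_ + _); rewrite addrCA.
  move=> h1 h2 ->.
  have p0 : p * (k * n - l * m) = 0.
    have -> : p * (k * n - l * m) = n * (p * k + q * m) - m * (p * l + q * n) by ring.
    by rewrite h1 h2; ring.
  have q0 : q * (k * n - l * m) = 0.
    have -> : q * (k * n - l * m) = k * (p * l + q * n) - l * (p * k + q * m) by ring.
    by rewrite h1 h2; ring.
  move: p0 q0 => /eqP; rewrite mulf_eq0 (negbTE det) orbF => /eqP-> /eqP.
  by rewrite mulf_eq0 (negbTE det) orbF => /eqP->.
- move=> u v; rewrite (E (fun x y => K x y u v)) ?Kxy ?mulr0 //.
    exact: altp_bilinl.
  by move=> *; rewrite altpCl.
- move=> f bf af; rewrite (E f) // => /eqP; rewrite mulf_eq0 (negbTE det) /= => /eqP.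
  exact: dm.
Qed.

Lemma alt_plane_rel x y z u w : alt_plane x y z -> G x w y u = G x u y w.
Proof.
case=> _ Kxy _; have := altp_symp WS x u y w; rewrite Kxy => /eqP.
by rewrite eq_sym subr_eq0 => /eqP <-; rewrite (sympC WS).
Qed.

Variables (q1 q2 : V -> V -> R).
Hypotheses (bq1 : bilin q1) (bq2 : bilin q2).
Hypotheses (sq1 : forall x y, q1 y x = q1 x y) (sq2 : forall x y, q2 y x = q2 x y).
Hypothesis iq : forall k l : R, (forall x y, k * q1 x y + l * q2 x y = 0) -> k = 0 /\ l = 0.
Hypothesis GE : forall x y z w, G x y z w = q1 x y * q1 z w + q2 x y * q2 z w.

Let dq (k l : R) : dominated S (fun x y => k * q1 x y + l * q2 x y).
Proof.
pose T (k : 'I_2) := if k == ord0 then q1 else q2.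
have bT k0 : bilin (T k0) by rewrite /T; case: ifP.
have d : forall k0, dominated S (T k0).
  apply: dom_gram => // s; rewrite !big_ord_recl big_ord0 addr0 /T /=.
  have -> : S = (fun x y z w => 1 * G x y z w + 1 * K x y z w).
    by apply: tensor4P => x y z w; rewrite !mul1r (symp_altp S).
  rewrite ev_comb !mul1r.
  have -> : G = (fun x y z w => 1 * (q1 x y * q1 z w) + 1 * (q2 x y * q2 z w)).
    by apply: tensor4P => x y z w; rewrite !mul1r GE.
  rewrite (ev_comb (fun x y z w => q1 x y * q1 z w) (fun x y z w => q2 x y * q2 z w)).
  rewrite (ev_prod q1 q1) (ev_prod q2 q2) !mul1r -!expr2.
  by have [_ _ h] := altp_psd CS; have := h s; lra.
exact: (dom_comb k l (d ord0) (d ord_max)).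
Qed.

(** A form of the pencil vanishing on the plane a3 = 0 is divisible by a3. If c is the other factor,
    the wedge of c and a3 vanishes on x /\ y, so it lies in the range of K. *)
Lemma type12_of_divisible x y z (k l : R) : alt_plane x y z -> (k != 0) || (l != 0) ->
  k * q1 x x + l * q2 x x = 0 -> k * q1 x y + l * q2 x y = 0 ->
  k * q1 y y + l * q2 y y = 0 -> type12 S.
Proof.
move=> [li _ dm] kl fxx fxy fyy; have [a1 [a2 [a3 D]]] := li3_dual dimV li.
pose f x y := k * q1 x y + l * q2 x y.
have bf : bilin f by exact: bilin_comb.
have sf u v : f v u = f u v by rewrite /f sq1 sq2.
pose c : 'Hom(V, R^o) := f x z *: a1 + f y z *: a2 + (2^-1 * f z z) *: a3.
have cE u : c u = f x z * a1 u + f y z * a2 u + 2^-1 * f z z * a3 u :> R.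
  by rewrite !add_lfunE !scale_lfunE.
have fE u v : f u v = c u * a3 v + a3 u * c v :> R.
  have Fxx : f x x = 0 by []. have Fxy : f x y = 0 by []. have Fyy : f y y = 0 by [].
  by rewrite (sym_expand D u v bf sf) !cE Fxx Fxy Fyy; field.
have [_ [a1x a1y a1z] [a2x a2y a2z] [a3x a3y a3z]] := D.
apply: (@dom_vee_wedge_type _ _ _ ext c a3).
- apply: contraTneq kl => c0.
  have [-> ->] : k = 0 /\ l = 0.
    by apply: iq => u v; rewrite -/(f u v) fE c0 !lfunE /=; ring.
  by rewrite eqxx.
- apply: contraTneq (oner_neq0 R) => a30; rewrite negbK -a3z a30 lfunE /= eqxx //.
- by apply: dom_eq (dq k l) => u v; rewrite -/(f u v) fE.
apply: dm.
- have := bilin_comb 1 (-1) (bilin_prod c a3) (bilin_prod a3 c).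
  by congr bilin; apply/funext => u; apply/funext => v; ring.
- by move=> u v; ring.
- by rewrite a3x a3y; ring.
Qed.

(** Write q = (q1, q2). Here q(x,y) = 0. If q(x,x) or q(y,y) vanishes, some form of the pencil
    vanishes on the plane. Otherwise they form an orthogonal basis of R^2, and correcting z makes
    q(x,z) and q(y,z) vanish, which leaves a pencil on V / y. *)
Lemma type12_of_orth_plane x y z : alt_plane x y z -> G x y x y = 0 -> type12 S.
Proof.
move=> pl G0; have rel u w := alt_plane_rel u w pl; have [li Kxy _] := pl.
have [q1xy q2xy] : q1 x y = 0 /\ q2 x y = 0.
  move: G0; rewrite GE -!expr2 => /eqP; rewrite paddr_eq0 ?sqr_ge0 // !sqrf_eq0.
  by case/andP=> /eqP-> /eqP->.
have [xx0|xx0] := eqVneq (q1 x x ^+ 2 + q2 x x ^+ 2) 0.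
  have [q1x q2x] : q1 x x = 0 /\ q2 x x = 0.
    move/eqP: xx0; rewrite paddr_eq0 ?sqr_ge0 // !sqrf_eq0.
    by case/andP=> /eqP-> /eqP->.
  have [h|h] := boolP ((q2 y y != 0) || (- q1 y y != 0)).
    by apply: (type12_of_divisible pl h); rewrite ?q1xy ?q2xy ?q1x ?q2x; ring.
  move: h; rewrite negb_or !negbK oppr_eq0 => /andP[/eqP q2y /eqP q1y].
  apply: (@type12_of_divisible x y z 1 0 pl); rewrite ?oner_neq0 // ?q1xy ?q2xy ?q1x ?q2x ?q1y ?q2y; ring.
have [yy0|yy0] := eqVneq (q1 y y ^+ 2 + q2 y y ^+ 2) 0.
  have [q1y q2y] : q1 y y = 0 /\ q2 y y = 0.
    move/eqP: yy0; rewrite paddr_eq0 ?sqr_ge0 // !sqrf_eq0.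
    by case/andP=> /eqP-> /eqP->.
  have [h|h] := boolP ((q2 x x != 0) || (- q1 x x != 0)).
    by apply: (type12_of_divisible pl h); rewrite ?q1xy ?q2xy ?q1y ?q2y; ring.
  move: h; rewrite negb_or !negbK oppr_eq0 => /andP[/eqP q2x /eqP q1x].
  by move: xx0; rewrite q1x q2x expr0n /= addr0 eqxx.
have orth : q1 x x * q1 y y + q2 x x * q2 y y = 0.
  by rewrite -GE; have := rel y x; rewrite !GE q1xy q2xy => ->; rewrite sq1 sq2 q1xy q2xy; ring.
have Gxxxx : G x x x x = q1 x x ^+ 2 + q2 x x ^+ 2 by rewrite GE !expr2.
have Gyyyy : G y y y y = q1 y y ^+ 2 + q2 y y ^+ 2 by rewrite GE !expr2.
(* By [alt_plane_rel], q(x,z) is orthogonal to q(y,y) and q(y,z) to q(x,x), so each is a multiple of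
   the other basis vector, and subtracting multiples of x and y removes it. *)
pose m := - (G x x x z / G x x x x); pose n := - (G y y y z / G y y y y).
pose z' := z + m *: x + n *: y.
have li' : li3 x y z' by exact: li3_add.
have qz q u : bilin q -> q u z' = q u z + m * q u x + n * q u y.
  by move=> bq; rewrite /z' !(bilinDr bq) !(bilinZr bq).
clearbody z'.
have xz' : q1 x z' = 0 /\ q2 x z' = 0.
  apply: (plane_orth_eq0 xx0 yy0 orth).
    rewrite !qz // q1xy q2xy !mulr0 !addr0.
    have -> : (q1 x z + m * q1 x x) * q1 x x + (q2 x z + m * q2 x x) * q2 x x =
       G x x x z + m * G x x x x by rewrite !GE; ring.
    by rewrite /m; field; rewrite Gxxxx.
  have h := rel y z; move: h; rewrite !GE q1xy q2xy !mul0r addr0 => h.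
  rewrite !qz // q1xy q2xy !mulr0 !addr0.
  have -> : (q1 x z + m * q1 x x) * q1 y y + (q2 x z + m * q2 x x) * q2 y y =
    (q1 x z * q1 y y + q2 x z * q2 y y) + m * (q1 x x * q1 y y + q2 x x * q2 y y) by ring.
  by rewrite h orth; ring.
have yz' : q1 y z' = 0 /\ q2 y z' = 0.
  apply: (plane_orth_eq0 xx0 yy0 orth).
    have h := rel z x; move: h; rewrite !GE (sq1 x y) (sq2 x y) q1xy q2xy !mulr0 addr0 => h.
    rewrite !qz // (sq1 x y) (sq2 x y) q1xy q2xy !mulr0 !addr0.
    have -> : (q1 y z + n * q1 y y) * q1 x x + (q2 y z + n * q2 y y) * q2 x x =
      (q1 x x * q1 y z + q2 x x * q2 y z) + n * (q1 x x * q1 y y + q2 x x * q2 y y) by ring.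
    by rewrite h orth; ring.
  rewrite !qz // (sq1 x y) (sq2 x y) q1xy q2xy !mulr0 !addr0.
  have -> : (q1 y z + n * q1 y y) * q1 y y + (q2 y z + n * q2 y y) * q2 y y =
     G y y y z + n * G y y y y by rewrite !GE; ring.
  by rewrite /n; field; rewrite Gyyyy.
apply: (product_of_pencil dimV ext (li3C12 li')) => [|u|u|u].
- by rewrite Gxxxx lt_def xx0 addr_ge0 // sqr_ge0.
- by rewrite (rel u x) GE (sq1 x y) (sq2 x y) q1xy q2xy; ring.
- by rewrite GE xz'.1 xz'.2; ring.
- rewrite (altp_symp WS x y z' u) !GE (sq1 y z') (sq2 y z') yz'.1 yz'.2 q1xy q2xy; ring.
Qed.

(** It suffices to find a basis u, v of the plane with q(u,v) = 0. *)
Lemma type12_of_alt_plane x y z : alt_plane x y z -> type12 S.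
Proof.
move=> pl; have rel u w := alt_plane_rel u w pl.
have [xx0|xx0] := eqVneq (G x x x x) 0.
  apply: (type12_of_orth_plane pl); rewrite (sympC WS x y y x) rel.
  by have := @psd_ker _ _ _ [:: (x, x)] [:: (y, y)] (symp_psd CS); rewrite !ev_seq1; exact.
pose t := - (G x x x y / G x x x x); pose y1 := t *: x + 1 *: y.
have pl1 : alt_plane x y1 z.
  have := @alt_plane_change x y z 1 0 t 1; rewrite scale1r scale0r addr0 mul0r subr0 mulr1.
  by apply => //; exact: oner_neq0.
have Gxxxy1 : G x x x y1 = 0.
  rewrite /y1 (bilinDr (symp_bilin ext _ _)) !(bilinZr (symp_bilin ext _ _)) /t; field.
  exact: xx0.
clearbody y1; have rel1 u w := alt_plane_rel u w pl1.
have [D0|D0] := eqVneq (G x y1 x y1) 0; first exact: (type12_of_orth_plane pl1 D0).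
pose A := G x x x x; pose D := G x y1 x y1; pose n := G x y1 y1 y1 / D.
have A0 : 0 < A by rewrite lt_def xx0 symp_ge0.
have Dpos : 0 < D by rewrite lt_def D0 symp_ge0.
have Gxxyy : G x x y1 y1 = D by rewrite rel1 (sympC WS).
have AE : A = q1 x x ^+ 2 + q2 x x ^+ 2 by rewrite /A GE !expr2.
have DE : D = q1 x y1 ^+ 2 + q2 x y1 ^+ 2 by rewrite /D GE !expr2.
have An0 : A != 0 by rewrite gt_eqF. have Dn0 : D != 0 by rewrite gt_eqF.
(* The vectors q(x,x) and q(x,y1) are an orthogonal basis of R^2, in which q(y1,y1) is expanded. *)
have yy : q1 y1 y1 - (D / A * q1 x x + n * q1 x y1) = 0 /\
          q2 y1 y1 - (D / A * q2 x x + n * q2 x y1) = 0.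
  apply: (@plane_orth_eq0 _ _ _ (q1 x x) (q2 x x) (q1 x y1) (q2 x y1)).
  - by rewrite -AE.
  - by rewrite -DE.
  - by rewrite -GE.
  - have -> : (q1 y1 y1 - (D / A * q1 x x + n * q1 x y1)) * q1 x x +
      (q2 y1 y1 - (D / A * q2 x x + n * q2 x y1)) * q2 x x =
      G x x y1 y1 - D / A * (q1 x x ^+ 2 + q2 x x ^+ 2) - n * G x x x y1 by rewrite !GE; ring.
    by rewrite -AE Gxxyy Gxxxy1; field.
  have -> : (q1 y1 y1 - (D / A * q1 x x + n * q1 x y1)) * q1 x y1 +
      (q2 y1 y1 - (D / A * q2 x x + n * q2 x y1)) * q2 x y1 =
      G x y1 y1 y1 - D / A * G x x x y1 - n * (q1 x y1 ^+ 2 + q2 x y1 ^+ 2) by rewrite !GE; ring.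
  by rewrite -DE Gxxxy1 /n; field; rewrite An0 Dn0.
(* For u = x + a y1 and v = x + b y1, q(u,v) = q(x,x) + (a + b) q(x,y1) + a b q(y1,y1) vanishes when
   a b = - A / D and a + b = n A / D. Since A / D > 0, the quadratic equation for a and b has
   distinct real roots. *)
pose s := n * A / D; pose r := Num.sqrt (s ^+ 2 + 4 * A / D).
have rr : r ^+ 2 = s ^+ 2 + 4 * A / D.
  rewrite sqr_sqrtr // addr_ge0 ?sqr_ge0 //.
  by rewrite divr_ge0 ?ltW // mulr_gt0.
have r0 : 0 < r.
  rewrite sqrtr_gt0 ltr_wpDl ?sqr_ge0 // divr_gt0 // mulr_gt0 //.
pose u := 1 *: x + ((s + r) / 2) *: y1; pose v := 1 *: x + ((s - r) / 2) *: y1.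
have pl2 : alt_plane u v z.
  apply: alt_plane_change pl1; rewrite !mul1r mulr1.
  have -> : (s - r) / 2 - (s + r) / 2 = - r by field.
  by rewrite oppr_eq0 gt_eqF.
have quv (q : V -> V -> R) : bilin q -> (forall x y, q y x = q x y) -> q u v = q x x + s * q x y1 - A / D * q y1 y1.
  move=> bq sq; rewrite /u /v !(bilinDl bq) !(bilinDr bq) !(bilinZl bq) !(bilinZr bq) (sq x y1).
  have -> : A / D = (r ^+ 2 - s ^+ 2) / 4 by rewrite rr; field.
  by field.
apply: (type12_of_orth_plane pl2); rewrite GE !quv //.
have [h1 h2] := yy; move/eqP: h1; move/eqP: h2; rewrite !subr_eq0 => /eqP-> /eqP->.
have z0 (q : V -> V -> R) : q x x + s * q x y1 - A / D * (D / A * q x x + n * q x y1) = 0.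
  by rewrite /s; field; rewrite An0 Dn0.
by rewrite !z0; ring.
Qed.

End RankTwoTwo.

Section RankTwoTwoFinal.
Variables (R : realType) (V : vectType R).
Hypothesis dimV : \dim {:V} = 3%N.
Variables (S : V -> V -> V -> V -> R) (ext : extremal (@C_W R V) S).
Local Notation G := (symp S).
Local Notation K := (altp S).

(** The kernels x and y of the two 2-forms span the plane: both forms vanish on x /\ y, and the
    2-forms that do so have dimension two. *)
Lemma type12_of_rank22 (q w : 'I_2 -> V -> V -> R) :
  (forall k, bilin (q k)) -> (forall k, bilin (w k)) ->
  (forall k x y, q k y x = q k x y) -> (forall k x y, w k y x = - w k x y) ->
  indep q -> indep w ->
  (forall x y z t, G x y z t = \sum_k q k x y * q k z t) ->
  (forall x y z t, K x y z t = \sum_k w k x y * w k z t) -> type12 S.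
Proof.
move=> bq bw sq aw iq iw Gq Kw; have [CS _ _] := ext.
have [e1 [e2 [e3 li]]] := exists_li3 dimV; have [a1 [a2 [a3 D]]] := li3_dual dimV li.
pose i0 : 'I_2 := ord0; pose i1 : 'I_2 := lift ord0 ord0.
have sum2 (F : 'I_2 -> R) : \sum_k F k = F i0 + F i1 by rewrite !big_ord_recl big_ord0 addr0.
have iE (T : 'I_2 -> V -> V -> R) (k l : R) : indep T ->
    (forall x y, k * T i0 x y + l * T i1 x y = 0) -> k = 0 /\ l = 0.
  move=> iT h; have h' : forall i, (if i == i0 then k else l) = 0.
    by apply: iT => x y; rewrite sum2 /=.
  by split; [have := h' i0|have := h' i1].
pose x := alt_kernel e1 e2 e3 (w i0); pose y := alt_kernel e1 e2 e3 (w i1).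
have wx u : w i0 x u = 0 by apply: (alt_kernelP D).
have wy u : w i1 y u = 0 by apply: (alt_kernelP D).
have l2 : li2 x y.
  move=> k l h; apply: (iE w) => //.
  apply: (alt_kernel_eq0 D) => //.
  - exact: bilin_comb.
  - by move=> u v; rewrite (aw i0) (aw i1); ring.
  by rewrite alt_kernel_comb.
have [z lz] := extend_li2 dimV l2; have [b1 [b2 [b3 D']]] := li3_dual dimV lz.
have alt0 f u : (forall x y : V, f y x = - f x y) -> f u u = 0 :> R.
  by move=> af; have := af u u; lra.
have xy1 : w i1 x y = 0 by rewrite aw wy oppr0.
have w0 : w i0 y z != 0.
  apply/eqP => yz0; have [] := iE w 1 0 iw; last by move=> /eqP; rewrite oner_eq0.
  by move=> u v; rewrite (alt_expand D' u v (bw i0)) // !wx yz0; ring.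
have w1 : w i1 x z != 0.
  apply/eqP => xz0; have [] := iE w 0 1 iw; last by move=> _ /eqP; rewrite oner_eq0.
  by move=> u v; rewrite (alt_expand D' u v (bw i1)) // xy1 wy xz0; ring.
have Wdom : forall k, dominated S (w k).
  apply: dom_gram => // s.
  have -> : S = (fun x y z w => 1 * G x y z w + 1 * K x y z w).
    by apply: tensor4P => x' y' z' w'; rewrite !mul1r (symp_altp S).
  rewrite ev_comb !mul1r.
  have -> : K = (fun x y z t => \sum_k w k x y * w k z t) by apply: tensor4P.
  rewrite ev_gram; have [_ _ h] := symp_psd CS; have := h s.
  by under [in X in _ -> _ <= X]eq_bigr do rewrite -expr2; lra.
apply: (@type12_of_alt_plane _ _ dimV S ext (q i0) (q i1) _ _ _ _ _ _ x y z) => //.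
- by move=> k l; exact: iE.
- by move=> x' y' z' w'; rewrite Gq sum2.
split=> //.
- by move=> u v; rewrite Kw sum2 wx xy1; ring.
move=> f bf af fxy.
apply: dom_eq (dom_comb (f y z / w i0 y z) (f x z / w i1 x z) (Wdom i0) (Wdom i1)) => u v.
rewrite (alt_expand D' u v (bw i0)) // (alt_expand D' u v (bw i1)) // (alt_expand D' u v bf) //.
by rewrite !wx xy1 wy fxy; field; rewrite w0 w1.
Qed.

End RankTwoTwoFinal.

(** * Real roots of cubics and singular matrices in a pencil *)

Lemma monic_cubic_root (R : rcfType) (b c d : R) :
  exists t, t ^+ 3 + b * t ^+ 2 + c * t + d = 0.
Proof.
pose p : {poly R} := 'X^3 + b *: 'X^2 + c *: 'X + d%:P.
have pE t : p.[t] = t ^+ 3 + b * t ^+ 2 + c * t + d by rewrite /p !hornerE.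
pose m := 1 + `|b| + `|c| + `|d|.
have [nb nc nd] : [/\ 0 <= `|b|, 0 <= `|c| & 0 <= `|d|] by [].
have m1 : 1 <= m by rewrite /m; lra.
(* The sign s treats p(m) >= 0 and - p(-m) >= 0 together; m is a bound for the roots. *)
have key (s : R) : s ^+ 2 = 1 -> 0 <= m ^+ 3 + s * (b * m ^+ 2) + c * m + s * d.
  move=> s1; have s2 : s = 1 \/ s = -1.
    by move/eqP: s1; rewrite sqrf_eq1 => /orP[/eqP|/eqP] ->; [left|right].
  have m0 : 0 <= m by lra.
  have mm : m <= m ^+ 2 by rewrite expr2 ler_peMl.
  have h1 : - (`|b| * m ^+ 2) <= s * (b * m ^+ 2).
    have := ler_norm b; have := ler_norm (- b); rewrite normrN => hb1 hb2.
    by case: s2 => ->; have := sqr_ge0 m; nra.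
  have h2 : - (`|c| * m ^+ 2) <= c * m.
    by have := ler_norm (- c); rewrite normrN; nra.
  have h3 : - (`|d| * m ^+ 2) <= s * d.
    have := ler_norm d; have := ler_norm (- d); rewrite normrN => hd1 hd2.
    by have : 1 <= m ^+ 2 by [lra]; case: s2 => ->; nra.
  have : m ^+ 3 = m ^+ 2 + `|b| * m ^+ 2 + `|c| * m ^+ 2 + `|d| * m ^+ 2.
    by rewrite exprS {1}/m; ring.
  by have := sqr_ge0 m; lra.
have [||t _ /rootP] := @poly_ivt R p (- m) m.
- by lra.
- rewrite !pE; apply/andP; split.
    by have := key (-1); rewrite sqrrN expr1n => /(_ erefl); lra.
  by have := key 1; rewrite expr1n => /(_ erefl); lra.
by rewrite pE => h; exists t.
Qed.

Lemma eigenvalue3 (R : rcfType) (A : 'M[R]_3) : exists t, eigenvalue A t.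
Proof.
have [t ht] := monic_cubic_root (char_poly A)`_2 (char_poly A)`_1 (char_poly A)`_0.
exists t; rewrite eigenvalue_root_char; apply/rootP.
have m3 : (char_poly A)`_3 = 1.
  by have := char_poly_monic A; rewrite monicE /lead_coef size_char_poly => /eqP.
rewrite horner_coef size_char_poly !big_ord_recr big_ord0 /= m3 -[RHS]ht; ring.
Qed.

Lemma singular_pencil (R : rcfType) (X Y : 'M[R]_3) :
  exists (k l : R) (v : 'rV_3), [/\ (k != 0) || (l != 0), v != 0 & v *m (k *: X + l *: Y) = 0].
Proof.
have [Yu|Yu] := boolP (Y \in unitmx).
  have [t /eigenvalueP[v vE v0]] := eigenvalue3 (X *m invmx Y).
  exists 1, (- t), v; split=> //; first by rewrite oner_eq0.
  have -> : v *m (1 *: X + - t *: Y) = (v *m (X *m invmx Y) - t *: v) *m Y.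
    by rewrite mulmxBl -!mulmxA mulVmx // mulmx1 scale1r scaleNr mulmxDr mulmxN -scalemxAr -scalemxAl.
  by rewrite vE subrr mul0mx.
have : kermx Y != 0 by rewrite kermx_eq0 row_free_unit.
move=> /rowV0Pn[v /sub_kermxP vY v0]; exists 0, 1, v.
by rewrite oner_eq0 orbT scale0r scale1r add0r.
Qed.

(** * The normal form of type 3 *)

Section CaseOne.
Variables (R : realType) (V : vectType R).
Hypothesis dimV : \dim {:V} = 3%N.
Variables (S : V -> V -> V -> V -> R) (CS : C_W S).
Implicit Types (a b : 'Hom(V, R^o)) (x y z p u v e : V) (f : V -> V -> R).
Local Notation G := (symp S).
Local Notation K := (altp S).

Let WS : Wsym S. Proof. by case: ((C_WP S).1 CS). Qed.

(** It is enough to look for e in the span of e1 and e2, where the matrices of q(e, . ) form a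
    pencil of 3 by 3 matrices. *)
Lemma exists_singular_symp (q : 'I_3 -> V -> V -> R) : (forall k, bilin (q k)) ->
  (forall x y z t, G x y z t = \sum_k q k x y * q k z t) ->
  exists e y, [/\ e != 0, y != 0 & G e y e y = 0].
Proof.
move=> bq Gq; have [e1 [e2 [e3 li]]] := exists_li3 dimV.
pose E (j : 'I_3) := nth 0 [:: e1; e2; e3] j.
pose X : 'M[R]_3 := \matrix_(j, k) q k e1 (E j).
pose Y : 'M[R]_3 := \matrix_(j, k) q k e2 (E j).
have [k [l [v [kl v0 vXY]]]] := singular_pencil X Y.
pose y := \sum_j v 0 j *: E j.
have yE : y = v 0 (@Ordinal 3 0 isT) *: e1 + v 0 (@Ordinal 3 1 isT) *: e2 + v 0 (@Ordinal 3 2 isT) *: e3.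
  rewrite /y !big_ord_recl big_ord0 addr0 addrA.
  by congr (v 0 _ *: _ + v 0 _ *: _ + v 0 _ *: _); apply: val_inj.
exists (k *: e1 + l *: e2), y; split.
- apply: contraTneq kl => h; have [-> -> _] : [/\ k = 0, l = 0 & 0 = 0 :> R].
    by apply: li; rewrite scale0r addr0.
  by rewrite eqxx.
- apply: contraNneq v0; rewrite yE => /li[h1 h2 h3]; apply/eqP/rowP => j; rewrite mxE.
  case: j => [[|[|[|//]]] lt]; [rewrite -[RHS]h1|rewrite -[RHS]h2|rewrite -[RHS]h3];
    by congr (v _ _); apply: val_inj.
have q0 i : q i (k *: e1 + l *: e2) y = 0.
  have := congr1 (fun A : 'rV[R]_3 => A 0 i) vXY; rewrite !mxE => <-.
  rewrite (bilinDl (bq i)) !(bilinZl (bq i)) /y.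
  have sE x : q i x (\sum_j v 0 j *: E j) = \sum_j v 0 j * q i x (E j).
    elim/big_rec2: _ => [|j u w _ <-]; first exact: bilin0r.
    by rewrite (bilinDr (bq i)) (bilinZr (bq i)).
  rewrite !sE !mulr_sumr -big_split; apply: eq_bigr => j _ /=; rewrite !mxE; ring.
by rewrite Gq big1 // => i _; rewrite q0 mul0r.
Qed.

Let bl := (symp_mult4 WS).1.
Let br := (symp_mult4 WS).2.

(** Orthonormality refers to the inner product G(e, e, . , . ). The free rotation of the plane
    orthogonal to e is used to make y a zero of the cubic G(e, . , . , . ). *)
Lemma eps_normal_basis e0 : e0 != 0 -> (forall x y z, K e0 x y z = 0) ->
  (forall y, y != 0 -> 0 < G e0 y e0 y) ->
  exists e y z, [/\ forall x y z, K e x y z = 0, li3 e y z,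
    [/\ G e e e e = 1, G e e e y = 0 & G e e e z = 0],
    [/\ G e e y y = 1, G e e y z = 0 & G e e z z = 1] & G e y y y = 0].
Proof.
move=> e00 K0 pos0; have Apos := pos0 _ e00.
(* G(e,e,e,e) is homogeneous of degree four, hence the fourth root. *)
pose a := (Num.sqrt (Num.sqrt (G e0 e0 e0 e0)))^-1.
have a0 : 0 < a by rewrite invr_gt0 !sqrtr_gt0.
have a4 : a ^+ 2 ^+ 2 * G e0 e0 e0 e0 = 1.
  by rewrite /a !exprVn !sqr_sqrtr ?sqrtr_ge0 ?ltW // mulVf // gt_eqF.
pose e := a *: e0.
have Ke x y z : K e x y z = 0.
  by rewrite /e (bilinZl ((altp_mult4 WS).1 _ _)) K0 mulr0.
have pos y : y != 0 -> 0 < G e y e y.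
  move=> /pos0 h; rewrite /e (bilinZl (bl _ _)) (bilinZl (br _ _)).
  by rewrite mulr_gt0 // mulr_gt0.
have Geeee : G e e e e = 1.
  rewrite -a4 /e !(bilinZl (bl _ _)) !(bilinZr (bl _ _)) !(bilinZl (br _ _)) !(bilinZr (br _ _)); ring.
have e_neq0 : e != 0 by rewrite scaler_eq0 negb_or e00 gt_eqF.
clearbody e.
have C12 x y z : G e x y z = G e y x z.
  have := altp_symp WS e y z x; rewrite Ke => /eqP.
  by rewrite eq_sym subr_eq0 => /eqP; rewrite (sympC WS e x) => ->; rewrite (sympC WS).
have C23 x y z : G e x y z = G e x z y by rewrite (sympC WS).
have [y0 [z0 li0]] := extend_neq0 dimV e_neq0.
have [y1 [z1 [li1 ey1 ez1]]] : exists y1 z1, [/\ li3 e y1 z1, G e e e y1 = 0 & G e e e z1 = 0].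
  exists (y0 + (- G e e e y0) *: e), (z0 + (- G e e e z0) *: e); split.
  - have h1 := @li3_add _ _ _ _ _ (- G e e e z0) 0 li0; rewrite scale0r addr0 in h1.
    have h2 := @li3_add _ _ _ _ _ (- G e e e y0) 0 (li3C23 h1); rewrite scale0r addr0 in h2.
    exact: li3C23.
  - by rewrite (bilinDr (br _ _)) (bilinZr (br _ _)) Geeee; ring.
  - by rewrite (bilinDr (br _ _)) (bilinZr (br _ _)) Geeee; ring.
(* A real binary cubic has a zero: either z1, or y1 + t z1 with t a root of the dehomogenised
   cubic. *)
have [y2 [z2 [li2 ey2 ez2 yyy2]]] : exists y2 z2,
    [/\ li3 e y2 z2, G e e e y2 = 0, G e e e z2 = 0 & G e y2 y2 y2 = 0].
  have [c0|c0] := eqVneq (G e z1 z1 z1) 0.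
    by exists z1, y1; split=> //; exact: li3C23.
  have [t ht] := monic_cubic_root (3 * G e y1 z1 z1 / G e z1 z1 z1)
    (3 * G e y1 y1 z1 / G e z1 z1 z1) (G e y1 y1 y1 / G e z1 z1 z1).
  exists (y1 + 0 *: e + t *: z1), z1; split=> //.
  - by apply: li3C23; have := @li3_add _ _ _ _ _ 0 t (li3C23 li1).
  - by rewrite scale0r addr0 (bilinDr (br _ _)) (bilinZr (br _ _)) ey1 ez1; ring.
  rewrite scale0r addr0 !(bilinDr (bl _ _)) !(bilinZr (bl _ _)) !(bilinDr (br _ _)).
  rewrite !(bilinDl (br _ _)) !(bilinZr (br _ _)) !(bilinZl (br _ _)).
  rewrite (C12 z1 y1 y1) (C23 y1 z1 y1) (C23 z1 z1 y1) (C12 z1 y1 z1).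
  have := congr1 (fun s => G e z1 z1 z1 * s) ht; rewrite mulr0 => <-.
  by field.
have y20 : y2 != 0 := li3_neq0 (li3C12 li2).
have ypos := pos _ y20.
pose r := Num.sqrt (G e y2 e y2).
have r0 : 0 < r by rewrite sqrtr_gt0.
have rr : r ^+ 2 = G e y2 e y2 by rewrite sqr_sqrtr // ltW.
have one0 : (1 : R) != 0 by exact: oner_neq0.
have [y [z3 [li3' ey3 ez3 yyy3 yy3]]] : exists y z3,
    [/\ li3 e y z3, G e e e y = 0, G e e e z3 = 0, G e y y y = 0 & G e e y y = 1].
  exists (r^-1 *: y2), z2; split=> //.
  - have := @li3_scale _ _ e y2 z2 1 r^-1 1 one0 _ one0 li2.
    by rewrite !scale1r; apply; rewrite invr_eq0 gt_eqF.
  - by rewrite (bilinZr (br _ _)) ey2 mulr0.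
  - by rewrite (bilinZr (bl _ _)) (bilinZr (br _ _)) (bilinZl (br _ _)) yyy2; ring.
  rewrite (bilinZr (br _ _)) (bilinZl (br _ _)) C12 -rr; field; exact: lt0r_neq0.
have [z4 [li4 ez4 yz4]] : exists z4, [/\ li3 e y z4, G e e e z4 = 0 & G e e y z4 = 0].
  exists (z3 + 0 *: e + (- G e e y z3) *: y); split; first exact: li3_add.
  - by rewrite scale0r addr0 (bilinDr (br _ _)) (bilinZr (br _ _)) ey3 ez3; ring.
  - by rewrite scale0r addr0 (bilinDr (br _ _)) (bilinZr (br _ _)) yy3; ring.
have z40 : z4 != 0 by apply: (@li3_neq0 _ _ _ e y); apply: li3C12; apply: li3C23.
have zpos := pos _ z40.
pose s := Num.sqrt (G e z4 e z4).
have s0 : 0 < s by rewrite sqrtr_gt0.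
have ss : s ^+ 2 = G e z4 e z4 by rewrite sqr_sqrtr // ltW.
exists e, y, (s^-1 *: z4); split=> //.
- have := @li3_scale _ _ e y z4 1 1 s^-1 one0 one0 _ li4.
  by rewrite !scale1r; apply; rewrite invr_eq0 gt_eqF.
- by split=> //; rewrite (bilinZr (br _ _)) ez4 mulr0.
split=> //; first by rewrite (bilinZr (br _ _)) yz4 mulr0.
by rewrite (bilinZr (br _ _)) (bilinZl (br _ _)) C12 -ss; field; exact: lt0r_neq0.
Qed.

(** The right-hand side is the Gram form of type 3. In the dual of the normal basis e, y, z, its
    three quadratic forms are G(e,e, . , . ), G(e,y, . , . ) and G(e,z, . , . ). *)
Lemma type3E a1 a2 a3 (g d h : R) x y z w :
  (S_tot a1 a2 a3 d g h + (2 * (g ^+ 2 + d ^+ 2 - 1 - d * h)) *: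
     (otimes2 (otimes a2 a3) (otimes a2 a3) + otimes2 (otimes a3 a2) (otimes a3 a2))) x y z w =
  (a1 x * a1 y + a2 x * a2 y + a3 x * a3 y) * (a1 z * a1 w + a2 z * a2 w + a3 z * a3 w) +
  (a1 x * a2 y + a2 x * a1 y + d * (a2 x * a3 y + a3 x * a2 y) + g * (a3 x * a3 y)) *
  (a1 z * a2 w + a2 z * a1 w + d * (a2 z * a3 w + a3 z * a2 w) + g * (a3 z * a3 w)) +
  (a1 x * a3 y + a3 x * a1 y + d * (a2 x * a2 y) + g * (a2 x * a3 y + a3 x * a2 y) + h * (a3 x * a3 y)) *
  (a1 z * a3 w + a3 z * a1 w + d * (a2 z * a2 w) + g * (a2 z * a3 w + a3 z * a2 w) + h * (a3 z * a3 w)) +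
  (g ^+ 2 + d ^+ 2 - 1 - d * h) * ((a2 x * a3 y - a3 x * a2 y) * (a2 z * a3 w - a3 z * a2 w)) :> R.
Proof.
rewrite /S_tot.
pose P (u1 u2 u3 u4 : 'Hom(V, R^o)) : R := sprod4 u1 u2 u3 u4 x y z w.
rewrite -[LHS]/(P a1 a1 a1 a1 + 6 * P a1 a1 a2 a2 + 6 * P a1 a1 a3 a3
  + 12 * d * P a1 a2 a2 a3 + 12 * g * P a1 a2 a3 a3 + 4 * h * P a1 a3 a3 a3
  + (1 + d ^+ 2) * P a2 a2 a2 a2 + 4 * d * g * P a2 a2 a2 a3
  + 6 * (1 + d * h) * P a2 a2 a3 a3 + 4 * g * (d + h) * P a2 a3 a3 a3
  + (1 + g ^+ 2 + h ^+ 2) * P a3 a3 a3 a3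
  + (2 * (g ^+ 2 + d ^+ 2 - 1 - d * h)) *
    ((a2 x * a3 y) * (a2 z * a3 w) + (a3 x * a2 y) * (a3 z * a2 w))).
rewrite /P !sprod4E.
move: (a1 x : R) (a1 y : R) (a1 z : R) (a1 w : R) (a2 x : R) (a2 y : R) (a2 z : R) (a2 w : R)
  (a3 x : R) (a3 y : R) (a3 z : R) (a3 w : R) => x1 y1 z1 w1 x2 y2 z2 w2 x3 y3 z3 w3.
by field.
Qed.

Definition type3 T := exists (a1 a2 a3 : 'Hom(V, R^o)) (g d h : R),
  [/\ basis_of {:'Hom(V, R^o)} [:: a1; a2; a3], g ^+ 2 > 1 - d ^+ 2 + d * h &
      T = S_tot a1 a2 a3 d g h + (2 * (g ^+ 2 + d ^+ 2 - 1 - d * h)) *: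
            (otimes2 (otimes a2 a3) (otimes a2 a3) + otimes2 (otimes a3 a2) (otimes a3 a2))].

Lemma type3_of_eps (q : 'I_3 -> V -> V -> R) e0 :
  (forall x y z t, G x y z t = \sum_k q k x y * q k z t) ->
  e0 != 0 -> (forall x y z, K e0 x y z = 0) -> (forall y, y != 0 -> 0 < G e0 y e0 y) ->
  (exists x y, K x y x y != 0) -> type3 S.
Proof.
move=> Gq e00 K0 pos Kn0.
have [e [y [z [Ke li [eee eey eez] [eyy eyz ezz] yyy]]]] := eps_normal_basis e00 K0 pos.
have C12 u v t : G e u v t = G e v u t.
  have := altp_symp WS e v t u; rewrite Ke => /eqP.
  by rewrite eq_sym subr_eq0 => /eqP; rewrite (sympC WS e u) => ->; rewrite (sympC WS).
have C23 u v t : G e u v t = G e u t v by rewrite (sympC WS).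
have [a1 [a2 [a3 D]]] := li3_dual dimV li.
pose b (j : 'I_3) := nth 0 [:: e; y; z] j.
pose P : 'M[R]_3 := \matrix_(j, k) q k e (b j).
(* The vectors q(e,b_j) are orthonormal, so P is orthogonal and the forms G(e, b_j, . , . ) = sum_k
   P_jk q_k are another Gram decomposition of G. *)
have PP : P *m P^T = 1%:M.
  apply/matrixP => i j; rewrite !mxE.
  have -> : \sum_k P i k * P^T k j = G e (b i) e (b j).
    by rewrite Gq; apply: eq_bigr => k _; rewrite !mxE.
  have yee : G e y e e = 0 by rewrite C12 C23 eey.
  have zee : G e z e e = 0 by rewrite C12 C23 eez.
  have yey : G e y e y = 1 by rewrite C12.
  have zez : G e z e z = 1 by rewrite C12.
  have yez : G e y e z = 0 by rewrite C12.
  have zey : G e z e y = 0 by rewrite C12 C23.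
  by case: i => [[|[|[|//]]] li']; case: j => [[|[|[|//]]] lj]; rewrite /b /=.
have PtP k l : \sum_i P i k * P i l = (k == l)%:R.
  have := congr1 (fun A : 'M[R]_3 => A k l) (mulmx1C PP); rewrite !mxE => <-.
  by apply: eq_bigr => i _; rewrite !mxE.
have sum3 (F : 'I_3 -> R) : \sum_k F k =
    F (@Ordinal 3 0 isT) + F (@Ordinal 3 1 isT) + F (@Ordinal 3 2 isT).
  rewrite !big_ord_recl big_ord0 addr0 addrA.
  by congr (F _ + F _ + F _); apply: val_inj.
have GE u v t w : G u v t w = G e e u v * G e e t w + G e y u v * G e y t w + G e z u v * G e z t w.
  transitivity (\sum_i G e (b i) u v * G e (b i) t w); last by rewrite sum3.
  have E i u' v' : G e (b i) u' v' = \sum_k P i k * q k u' v'.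
    by rewrite Gq; apply: eq_bigr => k _; rewrite mxE.
  under [RHS]eq_bigr do rewrite !E mulr_suml.
  rewrite exchange_big Gq; apply: eq_bigr => k _ /=.
  under eq_bigr do rewrite mulr_sumr.
  rewrite exchange_big (bigD1 k) //= [X in _ = _ + X]big1 ?addr0.
    transitivity (\sum_i P i k * P i k * (q k u v * q k t w)).
      by rewrite -mulr_suml PtP eqxx mul1r.
    by apply: eq_bigr => i _; ring.
  move=> l lk; transitivity (\sum_i P i k * P i l * (q k u v * q l t w)).
    by apply: eq_bigr => i _; ring.
  by rewrite -mulr_suml PtP eq_sym (negbTE lk) mul0r.
pose d := G e y y z; pose g := G e y z z; pose h := G e z z z.
have sGe u v t : G e u t v = G e u v t by rewrite (sympC WS).
have E1 u v : G e e u v = a1 u * a1 v + a2 u * a2 v + a3 u * a3 v :> R.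
  by rewrite (sym_expand D u v (br _ _)) // eee eyy ezz eey eez eyz; ring.
have E2 u v : G e y u v = a1 u * a2 v + a2 u * a1 v + d * (a2 u * a3 v + a3 u * a2 v) +
    g * (a3 u * a3 v) :> R.
  rewrite (sym_expand D u v (br _ _)) // -/d -/g yyy (C12 y e e) (C23 e y e) eey.
  by rewrite (C12 y e y) (C12 y e z) eyy eyz; ring.
have E3 u v : G e z u v = a1 u * a3 v + a3 u * a1 v + d * (a2 u * a2 v) +
    g * (a2 u * a3 v + a3 u * a2 v) + h * (a3 u * a3 v) :> R.
  rewrite (sym_expand D u v (br _ _)) // -/h (C12 z e e) (C23 e z e) eez.
  rewrite (C12 z e y) (C23 e z y) eyz (C12 z e z) ezz (C12 z y y) (C23 y z y) -/d.
  by rewrite (C12 z y z) -/g; ring.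
have zyy : G e z y y = d by rewrite C12 C23.
have zyz : G e z y z = g by rewrite C12.
(* K vanishes on e, so this single value determines it; its positivity is the inequality of type
   3. *)
have kE : K y z y z = g ^+ 2 + d ^+ 2 - 1 - d * h.
  rewrite (altp_symp WS y y z z) (GE y z z y) (GE y y z z) (C23 e z y) (C23 y z y) (C23 z z y).
  by rewrite eyz eyy ezz zyy zyz yyy -/d -/g -/h; ring.
have KE u v t w : K u v t w = (g ^+ 2 + d ^+ 2 - 1 - d * h) *
    ((a2 u * a3 v - a3 u * a2 v) * (a2 t * a3 w - a3 t * a2 w)).
  have Ker u' v' w' : K u' v' e w' = 0 by rewrite (altp_sym4 WS) Ke.
  rewrite (alt_expand D t w ((altp_mult4 WS).2 u v)); last by move=> *; rewrite (altpC WS).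
  rewrite !Ker (alt_expand D u v ((altp_mult4 WS).1 y z)); last by move=> *; rewrite altpCl.
  by rewrite !Ke kE; ring.
have kap : 0 < g ^+ 2 + d ^+ 2 - 1 - d * h.
  rewrite lt_def; apply/andP; split.
    have [x [x' h0]] := Kn0; apply: contraNneq h0 => k0.
    by rewrite KE k0 mul0r.
  by rewrite -kE; have [_ _ p] := altp_psd CS; have := p [:: (y, z)]; rewrite ev_seq1.
exists a1, a2, a3, g, d, h; split.
- exact: dual3_basis D.
- by lra.
apply: tensor4P => u v t w.
by rewrite type3E (symp_altp S) GE KE !E1 !E2 !E3.
Qed.

End CaseOne.

(** The unknowns are the matrix entries of a summand in the Gram forms of type 3. After substitution
    the fourth and fifth relations become k c = 0 and k b = 0 with k the nonzero coefficient, so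
    that only A stays free. *)
Lemma tau_relations_solve (R : realFieldType) (A b c H22 H23 H33 H44 d g h : R) :
  g ^+ 2 + d ^+ 2 - 1 - d * h != 0 ->
  H22 = A + d * c -> H33 = A + g * b + h * c -> H23 = d * b + g * c ->
  d * H22 + g * H23 = c + d * H33 -> b + g * H22 + h * H23 = d * H23 + g * H33 ->
  A + g * b + h * c + d * (c + g * H23 + h * H33) =
    d ^+ 2 * H22 + 2 * d * g * H23 + g ^+ 2 * H33 - H44 ->
  [/\ c = 0, b = 0 & H44 = (g ^+ 2 + d ^+ 2 - 1 - d * h) * A].
Proof.
move=> k0 -> -> -> t4 t5 t6.
have c0 : c = 0 by apply: (mulIf k0); rewrite mul0r; lra.
have b0 : b = 0 by apply: (mulIf k0); rewrite mul0r; rewrite c0 in t5; lra.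
by split=> //; rewrite c0 b0 in t6; lra.
Qed.

(** * Extremal elements are of the three types *)

Section Classification.
Variables (R : realType) (V : vectType R).
Hypothesis dimV : \dim {:V} = 3%N.
Implicit Types (a b : 'Hom(V, R^o)) (x y z e : V).

Lemma extremal_type (S : V -> V -> V -> V -> R) :
  extremal (@C_W R V) S -> type12 S \/ type3 S.
Proof.
move=> ext; have [CS _ _] := ext.
have [r [q [bq sq iq Gq]]] := symp_gram dimV CS.
have [s [w [bw aw iw Kw]]] := altp_gram dimV CS.
have [r3 r3s r2s] := extremal_rank_bounds dimV ext bq bw sq aw iq iw Gq Kw.
have WS : Wsym S by case: ((C_WP S).1 CS).
have [r0|r0] := eqVneq r 0%N.
  exfalso; apply: (altp_of_symp_eq0 ext) => x y z t; rewrite Gq; subst r.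
  exact: big_ord0.
have [r1|r1] := eqVneq r 1%N.
  subst r; left; apply: (type12_of_rank1 dimV ext (bq ord0) (sq ord0)) => x y z t.
  by rewrite Gq big_ord1.
have r2 : (1 < r)%N by case: (r) r0 r1 => [|[]].
(* For r = 2 the family is padded with a zero form, as the pencil argument needs square matrices. *)
have [q' bq' Gq'] : exists2 q' : 'I_3 -> V -> V -> R, forall k, bilin (q' k) &
    forall x y z t, symp S x y z t = \sum_k q' k x y * q' k z t.
  have [r3'|r3'] := eqVneq r 3%N; first by subst r; exists q.
  have r2' : r = 2%N.
    by apply/eqP; rewrite eqn_leq r2 andbT -ltnS ltn_neqAle r3' r3.
  subst r; exists (fun k => if unlift ord0 k is Some j then q j else fun=> fun=> 0).
    by move=> k; case: unlift => [j|] //; split=> *; rewrite ?mulr0 ?addr0.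
  move=> x y z t; rewrite big_ord_recl unlift_none mul0r add0r Gq.
  by apply: eq_bigr => k _; rewrite liftK.
have [s0|s0] := eqVneq s 0%N.
  have K0 x y z t : altp S x y z t = 0 by rewrite Kw; subst s; exact: big_ord0.
  have [e [y [e0 y0 G0]]] := exists_singular_symp dimV bq' Gq'.
  by left; apply: (type12_of_degenerate dimV ext e0 y0).
have [s1|s1] := eqVneq s 1%N; last first.
  have s2 : (1 < s)%N by case: (s) s0 s1 => [|[]].
  have er : r = 2%N.
    apply/eqP; rewrite eqn_leq r2 andbT leqNgt; apply/negP => /r3s; rewrite leqNgt s2 //.
  have es : s = 2%N by apply/eqP; rewrite eqn_leq s2 andbT r2s.
  by subst r s; left; exact: (type12_of_rank22 dimV ext bq bw sq aw iq iw Gq Kw).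
subst s; have {}Kw x y z t : altp S x y z t = w ord0 x y * w ord0 z t by rewrite Kw big_ord1.
have [e1 [e2 [e3 li]]] := exists_li3 dimV; have [a1 [a2 [a3 D]]] := li3_dual dimV li.
have [x0 [y0 w0]] : exists x y, w ord0 x y != 0.
  apply: contrapT => h; have : (1 : R) = 0.
    apply: (iw (fun=> 1) _ ord0) => x y; rewrite big_ord1 mul1r.
    by apply: contrapT => /eqP h'; apply: h; exists x, y.
  by move/eqP; rewrite oner_eq0.
pose e := alt_kernel e1 e2 e3 (w ord0).
have we x : w ord0 e x = 0 by exact: (alt_kernelP D).
have e0 : e != 0.
  apply: contraNneq w0 => e0; apply/eqP.
  exact: (alt_kernel_eq0 D (bw ord0) (aw ord0) li e0).
have Ke x y z : altp S e x y z = 0 by rewrite Kw we mul0r.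
have [[y yn0 Gy]|h] := pselect (exists2 y, y != 0 & symp S e y e y = 0).
  by left; exact: (type12_of_degenerate dimV ext e0 yn0 Ke Gy).
right; apply: (type3_of_eps dimV CS Gq' e0 Ke).
  move=> y yn0; rewrite lt_def symp_ge0 // andbT.
  by apply/eqP => G0; apply: h; exists y.
by exists x0, y0; rewrite Kw mulf_neq0.
Qed.

Lemma homZr a (k : R) x : a (k *: x) = k * a x :> R.
Proof. by rewrite linearZ. Qed.

(** The matrix of values of the one-forms on a basis has independent rows, and its right inverse
    gives the coordinates of the dual vectors. *)
Lemma free_hom_dual n (X : n.-tuple 'Hom(V, R^o)) : free X ->
  exists e : 'I_n -> V, forall i j, (tnth X i) (e j) = (i == j)%:R :> R.
Proof.
move=> fX; have [e1 [e2 [e3 li]]] := exists_li3 dimV.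
have [b1 [b2 [b3 [E _ _ _]]]] := li3_dual dimV li.
pose B (j : 'I_3) := nth 0 [:: e1; e2; e3] j.
pose N : 'M[R]_(n, 3) := \matrix_(i, j) tnth X i (B j).
have : row_free N.
  rewrite -kermx_eq0; apply/negPn/negP => /rowV0Pn[v /sub_kermxP vN /eqP]; apply.
  apply/rowP => i; rewrite mxE; move/freeP: fX => /(_ (v 0)); apply => {i}.
  have sE x : (\sum_i0 v 0 i0 *: X`_i0) x = \sum_i0 v 0 i0 * tnth X i0 x :> R.
    rewrite sum_lfunE; apply: eq_bigr => j _.
    by rewrite scale_lfunE (tnth_nth 0).
  have B0 j : (\sum_i0 v 0 i0 *: X`_i0) (B j) = 0 :> R.
    have := congr1 (fun A : 'rV[R]_3 => A 0 j) vN; rewrite !mxE => <-.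
    by rewrite sE; apply: eq_bigr => k _; rewrite mxE.
  set u := \sum_i0 _ in B0 *; apply/lfunP => x; rewrite lfunE /= (E x).
  rewrite -addrA !homP homZr.
  have := B0 (@Ordinal 3 0 isT); have := B0 (@Ordinal 3 1 isT); have := B0 (@Ordinal 3 2 isT).
  by rewrite /B /= => -> -> ->; ring.
case/row_freeP => A NA; exists (fun j => \sum_k A k j *: B k) => i j.
have := congr1 (fun A : 'M[R]_n => A i j) NA; rewrite !mxE => <-.
rewrite linear_sum; apply: eq_bigr => k _; rewrite mxE linearZ.
by rewrite -[LHS]/(A k j * tnth X i (B k)) mulrC.
Qed.

(** * The three types are extremal *)

Section Converse.
Variables (S : V -> V -> V -> V -> R) (CS : C_W S).

Lemma extremal_of_dominated : S != 0 ->
  (forall X, C_W X -> (forall s, ev X s s <= ev S s s) ->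
     exists2 c : R, 0 <= c & forall x y z w, X x y z w = c * S x y z w) ->
  extremal (@C_W R V) S.
Proof.
move=> S0 h; split=> // X Y CX CY SXY.
have SE s : ev S s s = ev X s s + ev Y s s.
  have -> : S = fun x y z w => 1 * X x y z w + 1 * Y x y z w.
    by rewrite SXY; apply: tensor4P => x y z w; rewrite !mul1r.
  by rewrite ev_comb !mul1r.
have pX s : 0 <= ev X s s by have [_ _ p] := C_W_psdform CX.
have pY s : 0 <= ev Y s s by have [_ _ p] := C_W_psdform CY.
split.
  have [|c c0 hc] := h X CX; first by move=> s; rewrite SE lerDl.
  by exists c => //; apply: tensor4P => x y z w; rewrite hc.
have [|c c0 hc] := h Y CY; first by move=> s; rewrite SE lerDr.
by exists c => //; apply: tensor4P => x y z w; rewrite hc.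
Qed.

Section Summand.
Variables (X : V -> V -> V -> V -> R) (CX : C_W X).
Hypothesis XS : forall s, ev X s s <= ev S s s.

Let WX : Wsym X. Proof. by case: ((C_WP X).1 CX). Qed.
Let mX : mult4 X. Proof. by case: WX. Qed.

(** From 0 <= X <= S, a null vector of S is null for X, hence in its kernel. *)
Lemma summand_ker (N : seq (V * V)) z w :
  ev S N N = 0 -> ev2 (fun x y => X x y z w) N = 0.
Proof.
move=> h; have : ev X N [:: (z, w)] = 0.
  apply: (psd_ker _ (C_W_psdform CX)); apply/le_anti/andP; split; first by rewrite -h.
  by have [_ _ p] := C_W_psdform CX.
by move=> <-; apply: eq_bigr => p _; rewrite ev2_seq1.
Qed.

Lemma summand_ge0 x y : 0 <= X x y x y.
Proof. by have [_ _ p] := C_W_psdform CX; have := p [:: (x, y)]; rewrite ev_seq1. Qed.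

Lemma summand_type1 a : a != 0 -> (forall x y z w, S x y z w = a x * a y * (a z * a w)) ->
  exists2 c : R, 0 <= c & forall x y z w, X x y z w = c * S x y z w.
Proof.
move=> a0 SE; have [v av] := hom_neq0 a0.
have F x y z w : X x y z w = a x * a y * X v v z w.
  (* This difference of tensors has the value 0 under a (x) a, hence is null for S. *)
  have := @summand_ker ([:: (x, y)] ++ scal (- (a x * a y)) [:: (v, v)]) z w.
  have -> : S = fun x y z w => a x * a y * (a z * a w) by apply: tensor4P.
  rewrite (ev_prod (fun x y => a x * a y) (fun x y => a x * a y)).
  have ba := bilin_prod a a; have bX := mX.1 z w.
  rewrite !ev2_cat !ev2_scal // !ev2_seq1 av.
  by move=> /(_ _)/eqP; rewrite addr_eq0 => h; apply/eqP; rewrite -[X in _ == X]opprK -mulNr h //; ring.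
exists (X v v v v); first exact: summand_ge0.
by move=> x y z w; rewrite F (Wsym_sym4 WX z w v v) F SE; ring.
Qed.

Lemma summand_type2 a b : free [:: a; b] ->
  (forall x y z w, S x y z w = 2^-1 * (a x * b y * (a z * b w) + b x * a y * (b z * a w))) ->
  exists2 c : R, 0 <= c & forall x y z w, X x y z w = c * S x y z w.
Proof.
move=> fab SE; have [e he] := @free_hom_dual 2 [tuple a; b] fab.
pose i0 : 'I_2 := ord0; pose i1 : 'I_2 := lift ord0 ord0.
have a0 : a (e i0) = 1 :> R := he i0 i0. have a1 : a (e i1) = 0 :> R := he i0 i1.
have b0 : b (e i0) = 0 :> R := he i1 i0. have b1 : b (e i1) = 1 :> R := he i1 i1.
move: (e i0) (e i1) a0 a1 b0 b1 => e0 e1 a0 a1 b0 b1.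
have bab := bilin_prod a b; have bba := bilin_prod b a.
have F x y z w : X x y z w = a x * b y * X e0 e1 z w + b x * a y * X e1 e0 z w.
  have := @summand_ker ([:: (x, y)] ++ scal (- (a x * b y)) [:: (e0, e1)] ++
     scal (- (b x * a y)) [:: (e1, e0)]) z w.
  have -> : S = fun x y z w => 2^-1 * (a x * b y * (a z * b w)) + 2^-1 * (b x * a y * (b z * a w)).
    by apply: tensor4P => *; rewrite SE mulrDr.
  rewrite (ev_comb (fun x y z w => a x * b y * (a z * b w)) (fun x y z w => b x * a y * (b z * a w))).
  rewrite (ev_prod (fun x y => a x * b y) (fun x y => a x * b y)).
  rewrite (ev_prod (fun x y => b x * a y) (fun x y => b x * a y)).
  have bX := mX.1 z w.
  rewrite !ev2_cat !ev2_scal // !ev2_seq1 a0 a1 b0 b1.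
  by move=> h; have := h ltac:(ring); lra.
exists (2 * X e0 e1 e0 e1); first by rewrite mulr_ge0 // summand_ge0.
have [_ x13 xsw] := WX.
(* Exchanging slots 1 and 3 moves this cross term to X(e0,e0,e1,e1), which vanishes because a (x) b
   and b (x) a are both 0 at (e0, e0). *)
have h0 : X e1 e0 e0 e1 = 0.
  by rewrite (x13 e0 e0 e1 e1) F b0; ring.
have h0' : X e0 e1 e1 e0 = 0 by rewrite -xsw h0.
have h1 : X e1 e0 e1 e0 = X e0 e1 e0 e1 by rewrite xsw.
move=> x y z w; rewrite F (Wsym_sym4 WX z w e0 e1) (Wsym_sym4 WX z w e1 e0).
rewrite (F z w e0 e1) (F z w e1 e0).
by rewrite h0 h0' h1 SE; field.
Qed.

(** A summand is a symmetric matrix in the four Gram forms of S; swap invariance removes its cross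
    terms with the alternating one, and the six tau relations leave only the multiples of S. *)
Lemma summand_type3 a1 a2 a3 (g d h : R) : free [:: a1; a2; a3] ->
  0 < g ^+ 2 + d ^+ 2 - 1 - d * h ->
  (forall x y z w, S x y z w =
  (a1 x * a1 y + a2 x * a2 y + a3 x * a3 y) * (a1 z * a1 w + a2 z * a2 w + a3 z * a3 w) +
  (a1 x * a2 y + a2 x * a1 y + d * (a2 x * a3 y + a3 x * a2 y) + g * (a3 x * a3 y)) *
  (a1 z * a2 w + a2 z * a1 w + d * (a2 z * a3 w + a3 z * a2 w) + g * (a3 z * a3 w)) +
  (a1 x * a3 y + a3 x * a1 y + d * (a2 x * a2 y) + g * (a2 x * a3 y + a3 x * a2 y) + h * (a3 x * a3 y)) *
  (a1 z * a3 w + a3 z * a1 w + d * (a2 z * a2 w) + g * (a2 z * a3 w + a3 z * a2 w) + h * (a3 z * a3 w)) +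
  (g ^+ 2 + d ^+ 2 - 1 - d * h) * ((a2 x * a3 y - a3 x * a2 y) * (a2 z * a3 w - a3 z * a2 w))) ->
  exists2 c : R, 0 <= c & forall x y z w, X x y z w = c * S x y z w.
Proof.
set k := _ - d * h => fa k0 SE; have [e he] := @free_hom_dual 3 [tuple a1; a2; a3] fa.
pose i1 := @Ordinal 3 0 isT; pose i2 := @Ordinal 3 1 isT; pose i3 := @Ordinal 3 2 isT.
have h11 : a1 (e i1) = 1 :> R := he i1 i1. have h12 : a1 (e i2) = 0 :> R := he i1 i2.
have h13 : a1 (e i3) = 0 :> R := he i1 i3. have h21 : a2 (e i1) = 0 :> R := he i2 i1.
have h22 : a2 (e i2) = 1 :> R := he i2 i2. have h23 : a2 (e i3) = 0 :> R := he i2 i3.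
have h31 : a3 (e i1) = 0 :> R := he i3 i1. have h32 : a3 (e i2) = 0 :> R := he i3 i2.
have h33 : a3 (e i3) = 1 :> R := he i3 i3.
move: (e i1) (e i2) (e i3) h11 h12 h13 h21 h22 h23 h31 h32 h33 => e1 e2 e3.
move=> h11 h12 h13 h21 h22 h23 h31 h32 h33.
pose q1 x y : R := a1 x * a1 y + a2 x * a2 y + a3 x * a3 y.
pose q2 x y : R := a1 x * a2 y + a2 x * a1 y + d * (a2 x * a3 y + a3 x * a2 y) + g * (a3 x * a3 y).
pose q3 x y : R := a1 x * a3 y + a3 x * a1 y + d * (a2 x * a2 y) +
  g * (a2 x * a3 y + a3 x * a2 y) + h * (a3 x * a3 y).
pose o x y : R := a2 x * a3 y - a3 x * a2 y.
have bq1 : bilin q1 by split=> c x y z; rewrite /q1 !homP; ring.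
have bq2 : bilin q2 by split=> c x y z; rewrite /q2 !homP; ring.
have bq3 : bilin q3 by split=> c x y z; rewrite /q3 !homP; ring.
have bo : bilin o by split=> c x y z; rewrite /o !homP; ring.
have q1E : [/\ q1 e1 e1 = 1, q1 e1 e2 = 0, q1 e1 e3 = 0, q1 e2 e3 = 0 & q1 e3 e2 = 0].
  by rewrite /q1 h11 h12 h13 h21 h22 h23 h31 h32 h33; split; ring.
have q2E : [/\ q2 e1 e1 = 0, q2 e1 e2 = 1, q2 e1 e3 = 0, q2 e2 e3 = d & q2 e3 e2 = d].
  by rewrite /q2 h11 h12 h13 h21 h22 h23 h31 h32 h33; split; ring.
have q3E : [/\ q3 e1 e1 = 0, q3 e1 e2 = 0, q3 e1 e3 = 1, q3 e2 e3 = g & q3 e3 e2 = g].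
  by rewrite /q3 h11 h12 h13 h21 h22 h23 h31 h32 h33; split; ring.
have oE : [/\ o e1 e1 = 0, o e1 e2 = 0, o e1 e3 = 0, o e2 e3 = 1 & o e3 e2 = -1].
  by rewrite /o h21 h22 h23 h31 h32 h33; split; ring.
have F x y z w : X x y z w = q1 x y * X e1 e1 z w + q2 x y * X e1 e2 z w + q3 x y * X e1 e3 z w
   + o x y / 2 * (X e2 e3 z w - X e3 e2 z w).
  (* The tensors e1 (x) e_j and (e2 (x) e3 - e3 (x) e2) / 2 are dual to q1, q2, q3, o, so all four
     forms vanish on [N]. *)
  pose N := [:: (x, y)] ++ scal (- q1 x y) [:: (e1, e1)] ++
     scal (- q2 x y) [:: (e1, e2)] ++ scal (- q3 x y) [:: (e1, e3)] ++
     scal (- (o x y / 2)) [:: (e2, e3)] ++ scal (o x y / 2) [:: (e3, e2)].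
  have evN f : bilin f -> ev2 f N = f x y - q1 x y * f e1 e1 - q2 x y * f e1 e2
      - q3 x y * f e1 e3 - o x y / 2 * (f e2 e3 - f e3 e2).
    by move=> bf; rewrite /N !ev2_cat !ev2_scal // !ev2_seq1; ring.
  clearbody N; have := @summand_ker N z w.
  pose T (i : 'I_4) := nth o [:: q1; q2; q3; fun x y => Num.sqrt k * o x y] i.
  have bko : bilin (fun x y => Num.sqrt k * o x y) by exact: bilinZ.
  have -> : S = fun x y z w => \sum_i T i x y * T i z w.
    apply: tensor4P => x' y' z' w'; rewrite SE !big_ord_recl big_ord0 /T /= addr0 !addrA.
    congr (_ + _); rewrite -/(o x' y') -/(o z' w') mulrACA -expr2 sqr_sqrtr ?ltW //.
  rewrite ev_gram !big_ord_recl big_ord0 addr0 /T /= !ev2_mull.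
  rewrite !evN //; last exact: mX.1.
  have [-> -> -> -> ->] := q1E; have [-> -> -> -> ->] := q2E.
  have [-> -> -> -> ->] := q3E; have [-> -> -> -> ->] := oE.
  by move=> H; have := H ltac:(field); lra.
have [_ x13 xsw] := WX; have x24 := Wsym24 WX; have sX := Wsym_sym4 WX.
pose A := X e1 e1 e1 e1; pose b := X e1 e1 e1 e2; pose c := X e1 e1 e1 e3.
pose H22 := X e1 e2 e1 e2; pose H23 := X e1 e2 e1 e3; pose H33 := X e1 e3 e1 e3.
pose H44 := (X e2 e3 e2 e3 - X e2 e3 e3 e2) / 2.
have FF x y z w : X x y z w = A * (q1 x y * q1 z w) + b * (q1 x y * q2 z w + q2 x y * q1 z w) +
    c * (q1 x y * q3 z w + q3 x y * q1 z w) + H22 * (q2 x y * q2 z w) +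
    H23 * (q2 x y * q3 z w + q3 x y * q2 z w) + H33 * (q3 x y * q3 z w) + H44 * (o x y * o z w).
  have s21 z' w' : X e2 e1 z' w' = X e1 e2 z' w'.
    rewrite F /q1 /q2 /q3 /o h11 h12 h21 h22 h31 h32; ring.
  have s31 z' w' : X e3 e1 z' w' = X e1 e3 z' w'.
    rewrite F /q1 /q2 /q3 /o h11 h13 h21 h23 h31 h33; ring.
  have p1 : X e1 e1 e3 e2 = X e1 e1 e2 e3 by rewrite xsw.
  have p2 : X e1 e2 e3 e2 = X e1 e2 e2 e3 by rewrite -s21 xsw.
  have p3 : X e1 e3 e3 e2 = X e1 e3 e2 e3 by rewrite -s31 xsw.
  have E1 z' w' : X e1 e1 z' w' = A * q1 z' w' + b * q2 z' w' + c * q3 z' w'.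
    rewrite -sX F (sX e1 e1 e1 e2) (sX e1 e1 e1 e3) (sX e1 e1 e2 e3) (sX e1 e1 e3 e2) p1.
    by rewrite -/A -/b -/c; ring.
  have E2 z' w' : X e1 e2 z' w' = b * q1 z' w' + H22 * q2 z' w' + H23 * q3 z' w'.
    rewrite -sX F (sX e1 e2 e1 e3) (sX e1 e2 e2 e3) (sX e1 e2 e3 e2) p2.
    by rewrite -/b -/H22 -/H23; ring.
  have E3 z' w' : X e1 e3 z' w' = c * q1 z' w' + H23 * q2 z' w' + H33 * q3 z' w'.
    rewrite -sX F (sX e1 e3 e2 e3) (sX e1 e3 e3 e2) p3.
    by rewrite -/c -/H33 -/H23; ring.
  have E4 z' w' : X e2 e3 z' w' - X e3 e2 z' w' = 2 * H44 * o z' w'.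
    rewrite (sX z' w' e2 e3) (sX z' w' e3 e2) !(F z' w') p1 p2 p3.
    by rewrite (xsw e2 e3 e3 e2) (xsw e2 e3 e2 e3) /H44; field.
  by rewrite F E1 E2 E3 E4; field.
have ev1 : [/\ q1 e2 e2 = 1, q2 e2 e2 = 0, q3 e2 e2 = d & o e2 e2 = 0].
  by rewrite /q1 /q2 /q3 /o h12 h22 h32; split; ring.
have ev2 : [/\ q1 e3 e3 = 1, q2 e3 e3 = g, q3 e3 e3 = h & o e3 e3 = 0].
  by rewrite /q1 /q2 /q3 /o h13 h23 h33; split; ring.
have ev3 : [/\ q1 e2 e1 = 0, q2 e2 e1 = 1, q3 e2 e1 = 0 & o e2 e1 = 0].
  by rewrite /q1 /q2 /q3 /o h11 h12 h21 h22 h31 h32; split; ring.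
have ev4 : [/\ q1 e3 e1 = 0, q2 e3 e1 = 0, q3 e3 e1 = 1 & o e3 e1 = 0].
  by rewrite /q1 /q2 /q3 /o h11 h13 h21 h23 h31 h33; split; ring.
have [r111 r112 r113 r123 r132] := q1E; have [r211 r212 r213 r223 r232] := q2E.
have [r311 r312 r313 r323 r332] := q3E; have [r411 r412 r413 r423 r432] := oE.
have [r122 r222 r322 r422] := ev1; have [r133 r233 r333 r433] := ev2.
have [r121 r221 r321 r421] := ev3; have [r131 r231 r331 r431] := ev4.
(* A tuple of equations acts as a single rewriting rule, here the table of values of the four
   forms. *)
pose RR := (r111, r112, r113, r123, r132, r211, r212, r213, r223, r232, r311, r312, r313, r323,
  r332, r411, r412, r413, r423, r432, r122, r222, r322, r422, r133, r233, r333, r433, r121, r221,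
  r321, r421, r131, r231, r331, r431).
have {}SE x y z w : S x y z w = q1 x y * q1 z w + q2 x y * q2 z w + q3 x y * q3 z w +
    k * (o x y * o z w) by exact: SE.
clearbody q1 q2 q3 o A b c H22 H23 H33 H44.
(* The six relations are tau invariance on the index quadruples of the dimension count, the entries
   of a symmetric form on Lambda^2 V. *)
have t1 : H22 = A + d * c.
  have E := x24 e1 e1 e2 e2; rewrite !FF !RR in E; clear -E; lra.
have t2 : H33 = A + g * b + h * c.
  have E := x24 e1 e1 e3 e3; rewrite !FF !RR in E; clear -E; lra.
have t3 : H23 = d * b + g * c.
  have E := x24 e1 e1 e2 e3; rewrite !FF !RR in E; clear -E; lra.
have t4 : d * H22 + g * H23 = c + d * H33.
  have E := x24 e1 e2 e2 e3; rewrite !FF !RR in E; clear -E; lra.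
have t5 : b + g * H22 + h * H23 = d * H23 + g * H33.
  have E := x24 e1 e2 e3 e3; rewrite !FF !RR in E; clear -E; lra.
have t6 : A + g * b + h * c + d * (c + g * H23 + h * H33) =
    d ^+ 2 * H22 + 2 * d * g * H23 + g ^+ 2 * H33 - H44.
  have E := x24 e2 e2 e3 e3; rewrite !FF !RR in E; clear -E; lra.
have kn0 : k != 0 by rewrite gt_eqF.
have [c0 b0 H44E] := tau_relations_solve kn0 t1 t2 t3 t4 t5 t6.
exists A.
  by have := summand_ge0 e1 e1; rewrite FF !RR !(mulr0, mul0r, addr0, mulr1).
move=> x y z w; rewrite FF SE t1 t2 t3 c0 b0 H44E /k; ring.
Qed.

End Summand.
End Converse.

End Classification.

Theorem theorem4p1 (R : realType) (V : vectType R) (dimV : \dim {:V} = 3%N)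
    (S : tensor4 R V) (CS : C_W S) :
  extremal (@C_W R V) S <->
  [\/ exists2 a : 'Hom(V, R^o), a != 0 & S = sprod4 a a a a,
      exists a1 a2 : 'Hom(V, R^o), free [:: a1; a2] /\
        S = otimes2 (vee a1 a2) (vee a1 a2) + otimes2 (wedge a1 a2) (wedge a1 a2) |
      exists (a1 a2 a3 : 'Hom(V, R^o)) (g d h : R),
        [/\ basis_of {:'Hom(V, R^o)} [:: a1; a2; a3],
            g ^+ 2 > 1 - d ^+ 2 + d * h &
            S = S_tot a1 a2 a3 d g h
                + (2 * (g ^+ 2 + d ^+ 2 - 1 - d * h)) *:
                  (otimes2 (otimes a2 a3) (otimes a2 a3)
                   + otimes2 (otimes a3 a2) (otimes a3 a2))]].
Proof.
split=> [/(extremal_type dimV)[[h|h]|h]|h].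
- by constructor 1.
- by constructor 2.
- by constructor 3.
have neq0 x y z w : S x y z w != 0 -> S != 0 by apply: contraNneq => ->.
case: h => [[a a0 SE]|[a [b [fab SE]]]|[a1 [a2 [a3 [g [d [h [ba k0 SE]]]]]]]].
- apply: (extremal_of_dominated CS) => [|X CX XS].
    have [v av] := hom_neq0 a0; apply: (neq0 v v v v).
    by rewrite SE type1E av !mulr1 oner_eq0.
  by apply: (summand_type1 CX XS a0) => x y z w; rewrite SE type1E.
- apply: (extremal_of_dominated CS) => [|X CX XS].
    have [e he] := @free_hom_dual R V dimV 2 [tuple a; b] fab.
    apply: (neq0 (e ord0) (e ord_max) (e ord0) (e ord_max)).
    have h1 : a (e ord0) = 1 :> R := he ord0 ord0.
    have h2 : b (e ord_max) = 1 :> R := he ord_max ord_max.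
    have h3 : b (e ord0) = 0 :> R := he ord_max ord0.
    by rewrite SE type2E h1 h2 h3 !mul0r addr0 !mulr1 invr_eq0 pnatr_eq0.
  by apply: (summand_type2 dimV CX XS fab) => x y z w; rewrite SE type2E.
have kap : 0 < g ^+ 2 + d ^+ 2 - 1 - d * h by lra.
have fa := basis_free ba.
apply: (extremal_of_dominated CS) => [|X CX XS].
  have [e he] := @free_hom_dual R V dimV 3 [tuple a1; a2; a3] fa.
  have h1 : a1 (e ord0) = 1 :> R := he ord0 ord0.
  have h2 : a2 (e ord0) = 0 :> R := he (@Ordinal 3 1 isT) ord0.
  have h3 : a3 (e ord0) = 0 :> R := he (@Ordinal 3 2 isT) ord0.
  apply: (neq0 (e ord0) (e ord0) (e ord0) (e ord0)).
  rewrite SE type3E h1 h2 h3 !(mulr0, mul0r, addr0, mulr1, subrr) oner_eq0 //.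
by apply: (summand_type3 dimV CX XS fa kap) => x y z w; rewrite SE type3E.
Qed.
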